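(* Let $\alpha\in[0,1)$ and $n\ge1$. Then $\Phi_{\alpha,n}$ has finite limits as $x\to0^+$ and $x\to1^-$ (denoted $\Phi_{\alpha,n}(0)$ and $\Phi_{\alpha,n}(1)$), and satisfies $$|\Phi_{\alpha,n}(1)|=\sqrt{2-\alpha}$$ and $$\Phi_{\alpha,n}(0)\sim c^-_{\nu_\alpha,0}\,\sqrt{\frac{(2-\alpha)\pi}{2}}\,(j_{-\nu_\alpha+1,n})^{\frac12-\nu_\alpha}\quad\text{as }n\to+\infty.$$ In particular, the sequence $(\Phi_{\alpha,n}(0))_{n\ge1}$ is bounded if and only if $\alpha=0$.
   Context: For $\alpha\in[0,1)$ put $\nu_\alpha:=\frac{1-\alpha}{2-\alpha}$. $J_\nu$ is the Bessel function of the first kind of order $\nu$, $J_{\nu}(y)=\sum_{m\ge0}\frac{(-1)^m}{m!\,\Gamma(m+\nu+1)}(y/2)^{2m+\nu}$ for $y>0$, and $j_{-\nu_\alpha+1,n}$ is the $n$-th positive zero of $J_{-\nu_\alpha+1}$. The constant $c^-_{\nu_\alpha,0}:=\frac{2^{\nu_\alpha}}{\Gamma(1-\nu_\alpha)}$ is the coefficient of $y^{-\nu_\alpha}$ in the series of $J_{-\nu_\alpha}(y)$. For $n\ge1$, $\Phi_{\alpha,n}(x):=K_{\alpha,n}\,x^{\frac{1-\alpha}{2}}J_{-\nu_\alpha}\bigl(j_{-\nu_\alpha+1,n}\,x^{\frac{2-\alpha}{2}}\bigr)$, $x\in(0,1)$, where $K_{\alpha,n}>0$ is such that $\|\Phi_{\alpha,n}\|_{L^2(0,1)}=1$.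 The notation $a_n\sim b_n$ means $a_n/b_n\to1$. *)

(* Defs.v *)
From mathcomp Require Import all_boot all_order all_algebra.
From mathcomp Require Import all_classical all_reals all_analysis.

Set Implicit Arguments.
Unset Strict Implicit.
Unset Printing Implicit Defensive.

Import Order.TTheory GRing.Theory Num.Theory.
Import numFieldNormedType.Exports.

Local Open Scope classical_set_scope.
Local Open Scope card_scope.
Local Open Scope ring_scope.

(* Euler's integral: equal to the Gamma function for 0 < x only. *)
Definition Gamma {R : realType} (x : R) : R :=
  \int[lebesgue_measure]_(t in `]0, +oo[) (t `^ (x - 1) * expR (- t)).

(* Meant for y > 0 and nu > -1, so that Gamma is only used at positive
   arguments. *)
Definition besselJ {R : realType} (nu y : R) : R :=
  limn (series (fun m : nat =>
    (-1) ^+ m / (m`!%:R * Gamma (m%:R + nu + 1))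
      * (y / 2) `^ (2 * m%:R + nu))).

(* The n-th positive zero for n >= 1: the positive zero y of J_nu such that
   J_nu has exactly n zeros in ]0, y]. The default value 0 is taken if there is
   no such zero, in particular for n = 0. *)
Definition bessel_zero {R : realType} (nu : R) (n : nat) : R :=
  xget 0 [set y | [/\ 0 < y, besselJ nu y = 0
    & [set z | 0 < z <= y /\ besselJ nu z = 0] #= `I_n]].

Definition nu {R : realType} (alpha : R) : R := (1 - alpha) / (2 - alpha).

Definition cminus {R : realType} (nu : R) : R := 2 `^ nu / Gamma (1 - nu).

Definition j {R : realType} (alpha : R) (n : nat) : R :=
  bessel_zero (- nu alpha + 1) n.

Definition L2norm01 {R : realType} (f : R -> R) : \bar R :=
  'N[@lebesgue_measure R]_(2%:E) [EFin \o (f \_ `]0%R, 1%R[)]%E.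

Definition phi {R : realType} (alpha : R) (n : nat) (x : R) : R :=
  x `^ ((1 - alpha) / 2)
    * besselJ (- nu alpha) (j alpha n * x `^ ((2 - alpha) / 2)).

(* The K > 0 that makes K * phi alpha n a unit vector of L^2(0, 1), with default
   value 0 if there is none. *)
Definition Knorm {R : realType} (alpha : R) (n : nat) : R :=
  xget 0 [set K | 0 < K /\ L2norm01 (fun x => K * phi alpha n x) = 1%E].

Definition Phi {R : realType} (alpha : R) (n : nat) (x : R) : R :=
  Knorm alpha n * phi alpha n x.

(* Limits of Phi at the endpoints; [lim] is a total operator, so these values
   are meaningful only together with the convergence of Phi. *)
Definition Phi_at0 {R : realType} (alpha : R) (n : nat) : R :=
  lim (Phi alpha n x @[x --> 0^'+]).

Definition Phi_at1 {R : realType} (alpha : R) (n : nat) : R :=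
  lim (Phi alpha n x @[x --> 1^'-]).

(* Main.v *)
Require Import Defs.
From mathcomp Require Import all_boot all_order all_algebra.
From mathcomp Require Import all_classical all_reals all_analysis.
From mathcomp Require Import measurable_realfun ring lra.
Import Order.TTheory GRing.Theory Num.Theory.
Import numFieldNormedType.Exports.
Local Open Scope classical_set_scope.
Local Open Scope ring_scope.
Set Implicit Arguments.
Unset Strict Implicit.
Unset Printing Implicit Defensive.

(** Put k = 1/2 - nu and c = k + 1/2 = 1 - nu, and let g be the entire function
    g(t) = sum_i (-1)^i t^i / ((c)_i i!), with (c)_i the rising factorial. With
    t = (y/2)^2 one has
      J_{-nu}(y) = (y/2)^(-nu) g(t) / Gamma(c)   and
      J_{1-nu}(y) = - (y/2)^(1-nu) g'(t) / Gamma(c),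
    so the positive zeros of J_{1-nu} correspond to those of g'. Putting
    T_n = (j_n/2)^2, the unnormalized eigenfunction is
    phi_n(x) = phi_n(0) g(T_n x^(2-alpha)), which gives both boundary limits
    ([phiE]).

    Normalization. A primitive of g(T x^(2-alpha))^2, due to Lommel, is explicit
    in g and g' ([is_derive_lommel]); since g'(T_n) = 0 it yields
    K_n phi_n(0) = sqrt(2-alpha) / |g(T_n)| ([KnormE]). This is the value of
    Phi_n at 0, and multiplying by g(T_n) gives the value at 1. It remains to
    find the size of g at the zeros of g'.

    Asymptotics. The energy V(t) = t^k (g^2 + t g'^2 + k g g') satisfies
    V' = - (k/2) t^(k-1) g g', which is O(t^(-3/2) V); hence V converges at
    infinity, and V(T_n) = T_n^k g(T_n)^2. To compute the limit of V, deform g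
    into the polynomials 2F1(-j, j+k; c; d t) with d = 1/(j(j+k)), that is, into
    Gegenbauer polynomials of degree 2j. They have an energy that is controlled
    in the same way up to the end point t = 1/d, uniformly in j
    ([energy_compare]), and at the end point their value is given by the
    Chu-Vandermonde identity ([hyp_endpoint]). Letting j tend to infinity
    brackets V(t) between L exp(-t^(-1/2)) and L exp(t^(-1/2)), where
    L = Gamma(c)^2 / pi comes from Gamma(1/2) = sqrt(pi) and Gamma(x+s) ~ x^s Gamma(x) ([energy_bracket],
    [endpoint_energy_cvg]). So V tends to L, which is the asymptotic formula for
    Phi_n(0) = sqrt(2-alpha) T_n^(k/2) / sqrt(V(T_n)). As T_n tends to infinity,
    this is bounded exactly when k = 0, that is, when alpha = 0.

    Zeros. The differential equation of g forces g' to vanish beyond every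
    T ([no_eventual_sign]), and its zeros are simple ([hyp_no_double_zero]), so
    they do not accumulate: they can be enumerated, and j_n tends to infinity. *)

(** * Entire power series with factorial decay *)

(** A bound on the coefficients that guarantees convergence everywhere and is
    stable under termwise differentiation. *)
Definition exp_bounded {R : realType} (M r : R) (u : nat -> R) : Prop :=
  forall i, `|u i| <= M * (r ^+ i / i`!%:R).

Definition psum {R : realType} (u : nat -> R) (t : R) : R :=
  limn (pseries u t).

Lemma exp_bounded_le_term (R : realType) (M r t : R) (u : nat -> R) (i : nat) :
  exp_bounded M r u -> `|u i * t ^+ i| <= M * exp_coeff (r * `|t|) i.
Proof.
move=> uM; rewrite normrM normrX /exp_coeff /= exprMn.
have -> : M * (r ^+ i * `|t| ^+ i / i`!%:R)
  = M * (r ^+ i / i`!%:R) * `|t| ^+ i by ring.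
by rewrite ler_wpM2r// exprn_ge0.
Qed.

Lemma cvg_normed_pseries (R : realType) (M r t : R) (u : nat -> R) :
  exp_bounded M r u -> cvgn [normed pseries u t].
Proof.
move=> uM; apply: (@series_le_cvg _ (fun i => `|u i * t ^+ i|)
  (fun i => M * exp_coeff (r * `|t|) i)).
- by move=> i; exact: normr_ge0.
- by move=> i; apply: le_trans (exp_bounded_le_term t i uM).
- by move=> i; exact: exp_bounded_le_term.
- exact/is_cvg_seriesZ/is_cvg_series_exp_coeff.
Qed.

Lemma cvg_pseries (R : realType) (M r t : R) (u : nat -> R) :
  exp_bounded M r u -> pseries u t @ \oo --> psum u t.
Proof.
by move=> uM; apply: (@normed_cvg _ R^o); exact: cvg_normed_pseries uM.
Qed.

Lemma psum_bound (R : realType) (M r t : R) (u : nat -> R) :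
  exp_bounded M r u -> `|psum u t| <= M * expR (r * `|t|).
Proof.
move=> uM; have cu := cvg_normed_pseries (t := t) uM.
apply: (le_trans (@lim_series_norm _ R^o _ cu)).
rewrite /expR -[_ * _](lim_seriesZ M (is_cvg_series_exp_coeff (r * `|t|))).
apply: lim_series_le => //; first exact/is_cvg_seriesZ/is_cvg_series_exp_coeff.
by move=> i; exact: exp_bounded_le_term.
Qed.

Lemma exp_bounded_diffs (R : realType) (M r : R) (u : nat -> R) :
  exp_bounded M r u -> exp_bounded (M * r) r (pseries_diffs u).
Proof.
move=> uM i; rewrite /pseries_diffs normrM normr_nat.
apply: le_trans (ler_wpM2l (ler0n _ _) (uM i.+1)) _.
rewrite le_eqVlt; apply/orP; left; apply/eqP.
have h1 : (i.+1%:R : R) != 0 by rewrite pnatr_eq0.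
have h2 : (i`!%:R : R) != 0 by rewrite pnatr_eq0 -lt0n fact_gt0.
by rewrite factS natrM exprS; field; rewrite -natr1 in h1; apply/andP.
Qed.

Lemma is_derive_psum (R : realType) (M r t : R) (u : nat -> R) :
  exp_bounded M r u -> is_derive t 1 (psum u) (psum (pseries_diffs u) t).
Proof.
move=> uM; have u1M := exp_bounded_diffs uM; have u2M := exp_bounded_diffs u1M.
apply: (@pseries_snd_diffs _ _ (`|t| + 1)).
- by apply/cvg_ex; eexists; exact: cvg_pseries uM.
- by apply/cvg_ex; eexists; exact: cvg_pseries u1M.
- by apply/cvg_ex; eexists; exact: cvg_pseries u2M.
- by rewrite [ltRHS]ger0_norm ?addr_ge0// ltrDl.
Qed.

Lemma psum0 (R : realType) (u : nat -> R) : psum u 0 = u 0%N.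
Proof.
apply/cvg_lim => //; rewrite -cvg_shiftS.
rewrite [X in X @ \oo](_ : _ = cst (u 0%N)); first exact: cvg_cst.
apply/funext => n; rewrite /pseries /series /= big_nat_recl//=.
by rewrite expr0 mulr1 big1 ?addr0// => i _; rewrite exprS mul0r mulr0.
Qed.

(** The operator t d/dt multiplies the i-th coefficient by i; with it a
    differential equation reduces to an identity between coefficients. *)
Lemma cvg_pseries_theta (R : realType) (M r t : R) (u : nat -> R) :
  exp_bounded M r u ->
  pseries (fun i => i%:R * u i) t @ \oo --> t * psum (pseries_diffs u) t.
Proof.
move=> uM; rewrite -cvg_shiftS.
have -> : (fun n => pseries (fun i => i%:R * u i) t n.+1)
    = (fun n => t * pseries (pseries_diffs u) t n).
  apply/funext => n; rewrite /pseries /series /= big_nat_recl//= !mul0r add0r.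
  rewrite mulr_sumr; apply: eq_bigr => i _.
  by rewrite /pseries_diffs exprS; ring.
by apply: cvgM; [exact: cvg_cst | exact: cvg_pseries (exp_bounded_diffs uM)].
Qed.

(** * Coefficients of the deformed Bessel series *)

Definition rising {R : realType} (c : R) (i : nat) : R :=
  \prod_(l < i) (c + l%:R).

Lemma rising0 (R : realType) (c : R) : rising c 0 = 1.
Proof. by rewrite /rising big_ord0. Qed.

Lemma risingS (R : realType) (c : R) (i : nat) :
  rising c i.+1 = rising c i * (c + i%:R).
Proof. by rewrite /rising big_ord_recr. Qed.

Lemma risingSl (R : realType) (c : R) (i : nat) :
  rising c i.+1 = c * rising (c + 1) i.
Proof.
rewrite /rising big_ord_recl/= addr0; congr (_ * _); apply: eq_bigr => l _.
by rewrite /bump/= natrD addrA.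
Qed.

Lemma rising_gt0 (R : realType) (c : R) (i : nat) : 0 < c -> 0 < rising c i.
Proof.
by move=> c0; apply: prodr_gt0 => l _; rewrite ltr_wpDr.
Qed.

Lemma rising_ge (R : realType) (c : R) (i : nat) :
  1 / 2 <= c -> 1 / 2 <= rising c i.
Proof.
case: i => [|i] hc; first by rewrite rising0; lra.
rewrite risingSl; apply: (le_trans hc); rewrite ler_peMr//; first lra.
rewrite /rising; elim/big_ind: _ => // [x y|l _].
  by move=> hx hy; rewrite mulr_ege1.
by have := ler0n R l; lra.
Qed.

(** For d = 1/(j(j+k)) the i-th product is j(j-1)...(j-i+1) (j+k)_i /
    (j(j+k))^i: the Bessel coefficient is damped into a hypergeometric one, and
    vanishes for i > j. *)
Definition damping {R : realType} (k d : R) (i : nat) : R :=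
  \prod_(l < i) (1 - d * (l%:R * (l%:R + k))).

(** Coefficients of 0F1(; k+1/2; -t) when d = 0, and of the polynomial 2F1(-j,
    j+k; k+1/2; d t) when d = 1/(j(j+k)). *)
Definition coef {R : realType} (k d : R) (i : nat) : R :=
  (-1) ^+ i * damping k d i / (rising (k + 1 / 2) i * i`!%:R).

(** Holds for the parameters d of interest, namely 0 and 1/(j(j+k)); it makes
    the bounds on the coefficients uniform in d. *)
Definition admissible {R : realType} (k d : R) : Prop :=
  forall i, 0 <= damping k d i <= 1.

Lemma dampingS (R : realType) (k d : R) (i : nat) :
  damping k d i.+1 = damping k d i * (1 - d * (i%:R * (i%:R + k))).
Proof. by rewrite /damping big_ord_recr. Qed.

Lemma damping0r (R : realType) (k : R) (i : nat) : damping k 0 i = 1.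
Proof. by rewrite /damping big1// => l _; rewrite mul0r subr0. Qed.

Lemma admissible0 (R : realType) (k : R) : admissible k 0.
Proof. by move=> i; rewrite damping0r ler01 lexx. Qed.

Lemma coef0 (R : realType) (k d : R) : coef k d 0 = 1.
Proof. by rewrite /coef /damping big_ord0 rising0 expr0 fact0; field. Qed.

Lemma exp_bounded_coef (R : realType) (k d : R) :
  0 <= k -> admissible k d -> exp_bounded 2 1 (coef k d).
Proof.
move=> k0 adm i; rewrite /coef; set c := k + 1 / 2.
rewrite expr1n normrM normrM normrX normrN1 expr1n !mul1r.
have /andP[d0 d1] := adm i; rewrite (ger0_norm d0).
have hr : 1 / 2 <= rising c i by apply: rising_ge; rewrite /c; lra.
have hr0 : 0 < rising c i by lra.
have hf : 0 < i`!%:R :> R by rewrite ltr0n fact_gt0.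
rewrite ger0_norm; last by rewrite invr_ge0 ltW// mulr_gt0.
rewrite invfM [leLHS]mulrA ler_wpM2r ?invr_ge0 ?(ltW hf)//.
apply: (@le_trans _ _ (1 * (rising c i)^-1)).
  by rewrite ler_wpM2r// invr_ge0 ltW.
rewrite mul1r -[leRHS]invrK lef_pV2 ?posrE ?invr_gt0//; lra.
Qed.

(** The damping factors differ from 1 by at most d 4^i: this quantifies the
    convergence of the polynomials to the Bessel series. *)
Lemma exp_bounded_coef_sub (R : realType) (k d : R) :
  0 <= k <= 1 / 2 -> 0 <= d -> admissible k d ->
  exp_bounded (2 * d) 4 (fun i => coef k d i - coef k 0 i).
Proof.
move=> /andP[k0 k1] d0 adm i; rewrite /coef damping0r; set c := k + 1 / 2.
have hdamp : 0 <= 1 - damping k d i <= d * 4 ^+ i.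
  elim: i => [|i /andP[ih0 ih1]].
    by rewrite /damping big_ord0 subrr lexx expr0 mulr1.
  have /andP[h0 h1] := adm i; have /andP[_ h3] := adm i.+1.
  rewrite subr_ge0 h3/= dampingS exprS.
  have hx : 0 <= i%:R * (i%:R + k) <= 3 * 4 ^+ i.
    rewrite mulr_ge0 ?addr_ge0//=.
    have hi : i%:R <= 2 ^+ i :> R.
      by rewrite -natrX ler_nat ltnW// ltn_expl.
    have h2 : 1 <= 2 ^+ i :> R by rewrite exprn_ege1// ler1n.
    have -> : 4 ^+ i = 2 ^+ i * 2 ^+ i :> R by rewrite -exprMn -natrM.
    have := ler0n R i; move: hi h2; move: (2 ^+ i) (i%:R) => p q hq hp q0.
    have h6 : q * q <= p * p by apply: ler_pM.
    have h4 : q * k <= p * 1 by apply: ler_pM => //; lra.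
    have h5 : p * 1 <= p * p by rewrite ler_wpM2l//; lra.
    by rewrite mulrDr; lra.
  move: hx => /andP[]; move: (_ * (_ + k)) (damping k d i) h0 h1 ih0 ih1.
  move=> x p h0 h1 ih0 ih1 x0 x1.
  have h6 : p * (d * x) <= 1 * (d * x) by rewrite ler_wpM2r// mulr_ge0.
  have h7 : d * x <= d * (3 * 4 ^+ i) by rewrite ler_wpM2l.
  by move: h7 ih1; move: (4 ^+ i) => q; lra.
have hr : 1 / 2 <= rising c i by apply: rising_ge; rewrite /c; lra.
have hr0 : 0 < rising c i by lra.
have hf : 0 < i`!%:R :> R by rewrite ltr0n fact_gt0.
have -> : (-1) ^+ i * damping k d i / (rising c i * i`!%:R) -
    (-1) ^+ i * 1 / (rising c i * i`!%:R)
  = (-1) ^+ i * (- ((1 - damping k d i) / rising c i / i`!%:R)).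
  by field; rewrite !gt_eqF.
rewrite normrM normrX normrN1 expr1n mul1r normrN ger0_norm; last first.
  by case/andP: hdamp => h _; rewrite !divr_ge0// ltW.
rewrite mulrA ler_wpM2r ?invr_ge0 ?(ltW hf)//.
rewrite ler_pdivrMr; last lra.
case/andP: hdamp => _ h; apply: (le_trans h).
have h2 : 0 <= d * 4 ^+ i by rewrite mulr_ge0// exprn_ge0.
apply: (@le_trans _ _ (2 * d * 4 ^+ i * (1 / 2))); first by lra.
by rewrite ler_wpM2l// -mulrA mulr_ge0.
Qed.

(** * The deformed Bessel series, its differential equation and its energy *)

Lemma coefS (R : realType) (k d : R) (i : nat) : 0 <= k ->
  (k + 1 / 2 + i%:R) * (i.+1%:R * coef k d i.+1)
  = - (1 - d * (i%:R * (i%:R + k))) * coef k d i.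
Proof.
move=> k0; rewrite /coef risingS dampingS factS natrM exprS.
have hc : 0 < k + 1 / 2 by lra.
have hr := rising_gt0 i hc.
have h1 : (i.+1%:R : R) != 0 by rewrite pnatr_eq0.
have h2 : (i`!%:R : R) != 0 by rewrite pnatr_eq0 -lt0n fact_gt0.
have h3 : (k + 1 / 2 + i%:R : R) != 0 by rewrite gt_eqF// ltr_wpDr.
move: hc hr h1 h2 h3; set c := k + 1 / 2; set r := rising c i.
move=> _ /gt_eqF/negbT; move: r (i.+1%:R : R) (i`!%:R : R) (i%:R : R).
by move=> r n f x hr h1 h2 h3; field; rewrite h1 h2 h3 hr.
Qed.

Definition hyp {R : realType} (k d : R) : R -> R := psum (coef k d).
Definition dhyp {R : realType} (k d : R) : R -> R :=
  psum (pseries_diffs (coef k d)).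
Definition ddhyp {R : realType} (k d : R) : R -> R :=
  psum (pseries_diffs (pseries_diffs (coef k d))).

(** Termwise, this is the recurrence [coefS]. *)
Lemma hyp_ode (R : realType) (k d t : R) : 0 <= k -> admissible k d ->
  t * (1 - d * t) * ddhyp k d t + (k + 1 / 2 - (k + 1) * d * t) * dhyp k d t
    + hyp k d t = 0.
Proof.
move=> k0 adm; have gM := exp_bounded_coef k0 adm.
have dgM := exp_bounded_diffs gM.
set g := coef k d in gM dgM *; set dg := pseries_diffs g in dgM *.
have c0 : pseries g t @ \oo --> hyp k d t by exact: cvg_pseries.
have c1 : pseries dg t @ \oo --> dhyp k d t by exact: cvg_pseries.
have c2 : pseries (fun i => i%:R * g i) t @ \oo --> t * dhyp k d t.
  exact: cvg_pseries_theta.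
have c3 : pseries (fun i => i%:R * dg i) t @ \oo --> t * ddhyp k d t.
  exact: cvg_pseries_theta.
have c4 : pseries (fun i => i%:R * ((i%:R - 1) * g i)) t @ \oo
    --> t * (t * ddhyp k d t).
  rewrite -cvg_shiftS.
  have -> : (fun n => pseries (fun i => i%:R * ((i%:R - 1) * g i)) t n.+1)
      = (fun n => t * pseries (fun i => i%:R * dg i) t n).
    apply/funext => n; rewrite /pseries /series /= big_nat_recl//= !mul0r add0r.
    rewrite mulr_sumr; apply: eq_bigr => i _.
    by rewrite /dg /pseries_diffs exprS -natr1; ring.
  by apply: cvgM => //; exact: cvg_cst.
have cs : (fun n => pseries (fun i => i%:R * dg i) t n
    + (k + 1 / 2) * pseries dg t n
    - d * (pseries (fun i => i%:R * ((i%:R - 1) * g i)) t n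
            + (k + 1) * pseries (fun i => i%:R * g i) t n)
    + pseries g t n) @ \oo --> t * ddhyp k d t + (k + 1 / 2) * dhyp k d t
    - d * (t * (t * ddhyp k d t) + (k + 1) * (t * dhyp k d t)) + hyp k d t.
  apply: cvgD => //; apply: cvgB.
    by apply: cvgD => //; apply: cvgM => //; exact: cvg_cst.
  apply: cvgM; first exact: cvg_cst.
  by apply: cvgD => //; apply: cvgM => //; exact: cvg_cst.
have -> : t * (1 - d * t) * ddhyp k d t
    + (k + 1 / 2 - (k + 1) * d * t) * dhyp k d t + hyp k d t
  = t * ddhyp k d t + (k + 1 / 2) * dhyp k d t
    - d * (t * (t * ddhyp k d t) + (k + 1) * (t * dhyp k d t)) + hyp k d t.
  by ring.
move: cs => /cvg_lim <- //; apply/cvg_lim => //.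
rewrite [X in X @ \oo](_ : _ = cst 0); first exact: cvg_cst.
apply/funext => n; rewrite /pseries /series /= !mulr_sumr -!big_split/=.
rewrite mulr_sumr -sumrN -!big_split/= big1// => i _.
have := coefS d i k0; rewrite /dg /pseries_diffs -/g.
move: (g i) (g i.+1) => x y h.
have -> : i%:R * (i.+1%:R * y) * t ^+ i + (k + 1 / 2) * (i.+1%:R * y * t ^+ i)
  = ((k + 1 / 2 + i%:R) * (i.+1%:R * y)) * t ^+ i by ring.
by rewrite h; ring.
Qed.

Lemma is_derive_hyp (R : realType) (k d t : R) : 0 <= k -> admissible k d ->
  is_derive t 1 (hyp k d) (dhyp k d t).
Proof. by move=> k0 /(exp_bounded_coef k0)/is_derive_psum. Qed.

Lemma is_derive_dhyp (R : realType) (k d t : R) : 0 <= k -> admissible k d ->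
  is_derive t 1 (dhyp k d) (ddhyp k d t).
Proof.
by move=> k0 /(exp_bounded_coef k0)/exp_bounded_diffs/is_derive_psum.
Qed.

Lemma hyp0 (R : realType) (k d : R) : hyp k d 0 = 1.
Proof. by rewrite /hyp psum0 coef0. Qed.

Lemma hyp_sub_bound (R : realType) (k d t : R) :
  0 <= k <= 1 / 2 -> 0 <= d -> admissible k d ->
  `|hyp k d t - hyp k 0 t| <= d * (2 * expR (4 * `|t|)) /\
  `|dhyp k d t - dhyp k 0 t| <= d * (8 * expR (4 * `|t|)).
Proof.
move=> hk d0 adm; have k0 : 0 <= k by case/andP: hk.
have bM := exp_bounded_coef_sub hk d0 adm; have dbM := exp_bounded_diffs bM.
have gM := exp_bounded_coef k0 adm; have dgM := exp_bounded_diffs gM.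
have hM := exp_bounded_coef k0 (admissible0 k).
have dhM := exp_bounded_diffs hM.
have subE (M r M' r' : R) u v : exp_bounded M r u -> exp_bounded M' r' v ->
    psum u t - psum v t = psum (fun i => u i - v i) t.
  move=> uM vM; apply/esym/cvg_lim => //.
  rewrite [X in X @ \oo](_ : _ = (fun n => pseries u t n - pseries v t n)).
    by apply: cvgB; [exact: cvg_pseries uM | exact: cvg_pseries vM].
  apply/funext => n; rewrite /pseries /series /= -sumrB.
  by apply: eq_bigr => i _; rewrite mulrBl.
split.
  rewrite /hyp (subE _ _ _ _ _ _ gM hM); apply: le_trans (psum_bound t bM) _.
  by rewrite [2 * d]mulrC mulrA.
rewrite /dhyp (subE _ _ _ _ _ _ dgM dhM).
have -> : (fun i => pseries_diffs (coef k d) i - pseries_diffs (coef k 0) i)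
   = pseries_diffs (fun i => coef k d i - coef k 0 i).
  by apply/funext => i; rewrite /pseries_diffs mulrBr.
apply: le_trans (psum_bound t dbM) _.
by rewrite le_eqVlt; apply/orP; left; apply/eqP; ring.
Qed.

(** For d = 0 this is, up to a constant factor, y (J_{k-1/2}^2 + J_{k+1/2}^2)
    corrected by a multiple of J_{k-1/2} J_{k+1/2}, at t = (y/2)^2. The
    correction cancels the leading part of the derivative. *)
Definition energy {R : realType} (k d t : R) : R :=
  t `^ k * (hyp k d t ^+ 2 + t * (1 - d * t) * dhyp k d t ^+ 2
            + k * (1 - d * t) * (hyp k d t * dhyp k d t)).

(** The terms in [hyp ^+ 2] and [dhyp ^+ 2] of the derivative cancel once the
    second derivative is eliminated with the differential equation. *)
Lemma is_derive_energy (R : realType) (k d t : R) :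
  0 <= k -> admissible k d -> 0 < t ->
  is_derive t 1 (energy k d)
    (- (k / 2) * (t `^ k / t) * (hyp k d t * dhyp k d t)).
Proof.
move=> k0 adm t0.
have hg := is_derive_hyp t k0 adm; have hdg := is_derive_dhyp t k0 adm.
have hp := is_derive1_powR k t0.
apply: is_derive_eq.
have -> : t `^ (k - 1) = t `^ k / t.
  by rewrite powRB ?powRr1 ?(ltW t0)// (gt_eqF t0) implybT.
rewrite /GRing.scale/=.
have ode := hyp_ode t k0 adm.
move: ode; move: (hyp k d t) (dhyp k d t) (ddhyp k d t) (t `^ k) => g g1 g2 p.
set L := _ + _ + g => ode.
apply: (@etrans _ _ (- (k / 2) * (p / t) * (g * g1)
  + p * (2 * g1 + k / t * g) * L)); last by rewrite ode mulr0 addr0.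
by rewrite /L; field; rewrite gt_eqF.
Qed.

Lemma energy_continuous (R : realType) (k d t : R) :
  0 <= k -> admissible k d -> 0 < t -> {for t, continuous (energy k d)}.
Proof.
move=> k0 adm t0; apply: differentiable_continuous; apply/derivable1_diffP.
by apply: ex_derive; exact: is_derive_energy.
Qed.

(** With s = sqrt(1/t - d) and z = t s g', the energy is t^k (g^2 + z^2 + k s g
    z); as k s <= 1/2, it controls the product g z. The right-hand side is the
    energy times minus the derivative of sqrt(1/t - d). *)
Lemma energy_slope (R : realType) (k d t : R) :
  0 <= k <= 1 / 2 -> 0 <= d -> 1 <= t -> d * t < 1 ->
  `|- (k / 2) * (t `^ k / t) * (hyp k d t * dhyp k d t)|
    <= energy k d t / (2 * t ^+ 2 * Num.sqrt (t^-1 - d)).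
Proof.
move=> /andP[k0 k1] d0 t1 dt; have t0 : 0 < t by lra.
have s2 : 0 < t^-1 - d by rewrite subr_gt0 -(mul1r t^-1) ltr_pdivlMr.
have /sqr_sqrtr := ltW s2; have s0 : 0 < Num.sqrt (t^-1 - d).
  by rewrite sqrtr_gt0.
rewrite /energy; move: (hyp k d t) (dhyp k d t) (powR_ge0 t k).
move: (t `^ k) (Num.sqrt (t^-1 - d)) s0 => p s s0 g g1 p0 hs.
have hw : 1 - d * t = t * s ^+ 2 by rewrite hs mulrBr divff ?gt_eqF// mulrC.
have s1 : s <= 1.
  have t2 : t^-1 <= 1 by rewrite invf_le1.
  by rewrite -ler_sqr ?nnegrE ?(ltW s0)// expr1n hs; lra.
rewrite hw; pose z := t * s * g1.
have -> : - (k / 2) * (p / t) * (g * g1)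
    = p / (2 * t ^+ 2 * s) * - (k * (g * z)).
  by rewrite /z; field; rewrite !gt_eqF.
have -> : p * (g ^+ 2 + t * (t * s ^+ 2) * g1 ^+ 2
      + k * (t * s ^+ 2) * (g * g1)) / (2 * t ^+ 2 * s)
    = p / (2 * t ^+ 2 * s) * (g ^+ 2 + z ^+ 2 + k * s * (g * z)).
  by rewrite /z; field; rewrite !gt_eqF.
have h0 : 0 <= p / (2 * t ^+ 2 * s).
  by rewrite divr_ge0// ltW// !mulr_gt0// exprn_gt0.
rewrite normrM (ger0_norm h0) ler_wpM2l// normrN.
have hx : `|g * z| * 2 <= g ^+ 2 + z ^+ 2.
  have [h|h] := ger0P (g * z).
    by have := sqr_ge0 (g - z); nra.
  by have := sqr_ge0 (g + z); nra.
rewrite normrM (ger0_norm k0).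
have h1 : - (k * s * `|g * z|) <= k * s * (g * z).
  by rewrite -mulrN ler_wpM2l ?mulr_ge0 ?(ltW s0)//;
    have := ler_norm (- (g * z)); rewrite normrN; lra.
have h2 : k * s * `|g * z| <= 1 / 2 * `|g * z|.
  by rewrite ler_wpM2r//; nra.
have h3 : k * `|g * z| <= 1 / 2 * `|g * z| by rewrite ler_wpM2r.
by have := normr_ge0 (g * z); lra.
Qed.

(** By [energy_slope], the products of the energy with exp(sqrt(1/t - d)) and
    exp(- sqrt(1/t - d)) are monotone, in opposite directions, up to t = 1/d,
    where the square root vanishes. *)
Lemma energy_compare (R : realType) (k d t0 : R) :
  0 <= k <= 1 / 2 -> admissible k d -> 0 < d -> 1 <= t0 -> t0 < d^-1 ->
  energy k d t0 * expR (- Num.sqrt t0^-1) <= energy k d d^-1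
    <= energy k d t0 * expR (Num.sqrt t0^-1).
Proof.
move=> hk adm d0 t01 t0d; have k0 : 0 <= k by case/andP: hk.
have t00 : 0 < t0 by lra.
pose h (t : R) := Num.sqrt (t^-1 - d).
have hpos t : t \in `]t0, d^-1[ -> 0 < t^-1 - d.
  rewrite in_itv/= => /andP[t0t td]; rewrite subr_gt0 -[ltLHS]invrK.
  by rewrite ltf_pV2 ?posrE ?invr_gt0//; lra.
have dh t : t \in `]t0, d^-1[ ->
    is_derive t 1 h (- (2 * t ^+ 2 * Num.sqrt (t^-1 - d))^-1).
  move=> tt; have t0' : 0 < t by move: tt; rewrite in_itv/= => /andP[]; lra.
  have h0 := hpos t tt.
  have dV : is_derive t 1 (fun t : R => t^-1) (- t ^- 2 *: 1).
    by apply: is_deriveV; rewrite gt_eqF.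
  have dB : is_derive t 1 (fun t : R => t^-1 - d) (- t ^- 2).
    by apply: is_derive_eq; rewrite /GRing.scale/= mulr1 subr0.
  have dS := is_derive1_sqrt h0.
  have := @is_derive1_comp _ _ (fun t : R => t^-1 - d) t _ _ dS dB.
  move=> dC; apply: (@is_derive_eq _ _ _ _ _ _ _ _ dC).
  have := h0; rewrite -sqrtr_gt0 => s0.
  by field; rewrite !gt_eqF.
have ch t : 0 < t -> {for t, continuous h}.
  move=> t1; apply: continuous_comp; last exact: sqrt_continuous.
  by apply: cvgB; [apply: inv_continuous; rewrite gt_eqF | exact: cvg_cst].
have cE (e : R) t : t \in `[t0, d^-1] ->
    {for t, continuous (fun t => energy k d t * expR (e * h t))}.
  rewrite in_itv/= => /andP[t0t _]; have t1 : 0 < t by lra.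
  apply: cvgM; first exact: energy_continuous.
  apply: continuous_comp; last exact: continuous_expR.
  by apply: cvgM; [exact: cvg_cst | exact: ch].
have dE (e : R) t : t \in `]t0, d^-1[ ->
    is_derive t 1 (fun t => energy k d t * expR (e * h t))
      ((- (k / 2) * (t `^ k / t) * (hyp k d t * dhyp k d t)
        - e * (energy k d t / (2 * t ^+ 2 * Num.sqrt (t^-1 - d))))
       * expR (e * h t)).
  move=> tt; have t1 : 0 < t by move: tt; rewrite in_itv/= => /andP[]; lra.
  have d1 := is_derive_energy k0 adm t1; have d2 := dh t tt.
  have d4 : is_derive t 1 (fun t => e * h t)
      (e * (- (2 * t ^+ 2 * Num.sqrt (t^-1 - d))^-1)).
    by apply: is_derive_eq; rewrite /GRing.scale/=; ring.
  have d3 := @is_derive1_comp _ expR (fun t => e * h t) t _ _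
    (is_derive_expR _) d4.
  apply: (@is_derive_eq _ _ _ _ _ _ _ _ (is_deriveM d1 d3)).
  by rewrite /GRing.scale/=; ring.
have sl t : t \in `]t0, d^-1[ -> 
    `|- (k / 2) * (t `^ k / t) * (hyp k d t * dhyp k d t)|
    <= energy k d t / (2 * t ^+ 2 * Num.sqrt (t^-1 - d)).
  rewrite in_itv/= => /andP[t0t td]; apply: energy_slope => //; try lra.
  by rewrite -ltr_pdivlMl// mulr1.
have hend : h d^-1 = 0 by rewrite /h invrK subrr sqrtr0.
have hle : h t0 <= Num.sqrt t0^-1 by rewrite /h ler_wsqrtr//; lra.
have within e : {within `[t0, d^-1],
    continuous (fun t => energy k d t * expR (e * h t))}.
  apply: continuous_in_subspaceT => x; rewrite inE/= => xx; exact: cE.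
have m1 : energy k d t0 * expR (- 1 * h t0)
    <= energy k d d^-1 * expR (- 1 * h d^-1).
  apply: (@ger0_derive1_le_cc _ _ t0 d^-1) (within (- 1)) _ _ _ _ _ => //.
  - by move=> t tt; apply: ex_derive; exact: dE.
  - move=> t tt; rewrite derive1E (@derive_val _ _ _ _ _ _ _ (dE _ _ tt)).
    rewrite mulr_ge0 ?expR_ge0//.
    by have := sl t tt; rewrite ler_norml => /andP[]; lra.
  - by rewrite in_itv/= lexx ltW.
  - by rewrite in_itv/= lexx ltW.
  - exact: ltW.
have m2 : energy k d d^-1 * expR (1 * h d^-1)
    <= energy k d t0 * expR (1 * h t0).
  apply: (@ler0_derive1_le_cc _ _ t0 d^-1) (within 1) _ _ _ _ _ => //.
  - by move=> t tt; apply: ex_derive; exact: dE.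
  - move=> t tt; rewrite derive1E (@derive_val _ _ _ _ _ _ _ (dE _ _ tt)).
    rewrite mulr_le0_ge0 ?expR_ge0//.
    by have := sl t tt; rewrite ler_norml => /andP[]; lra.
  - by rewrite in_itv/= lexx ltW.
  - by rewrite in_itv/= lexx ltW.
  - exact: ltW.
move: m1 m2; rewrite hend !mulr0 expR0 !mulr1 mulN1r mul1r => m1 m2.
have e0 : 0 <= energy k d t0.
  have dt : d * t0 < 1 by rewrite -ltr_pdivlMl// mulr1.
  have := le_trans (normr_ge0 _) (energy_slope hk (ltW d0) t01 dt).
  rewrite pmulr_lge0// invr_gt0 !mulr_gt0 ?exprn_gt0// sqrtr_gt0 subr_gt0.
  by rewrite -(mul1r t0^-1) ltr_pdivlMr.
apply/andP; split.
  by apply: le_trans m1; rewrite ler_wpM2l// ler_expR lerN2.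
by apply: (le_trans m2); rewrite ler_wpM2l// ler_expR.
Qed.

(** * The polynomial members of the family and their values at the end point *)

(** Pascal's rule for the binomial coefficients reduces j + 1 to two sums with
    j, one with b and c shifted by 1. *)
Lemma chu_vandermonde (R : realType) (j : nat) (b c : R) : 0 < c ->
  \sum_(0 <= i < j.+1) (-1) ^+ i * ('C(j, i))%:R * (rising b i / rising c i)
    = rising (c - b) j / rising c j.
Proof.
elim: j b c => [|j IHj] b c c0.
  by rewrite big_nat1 expr0 bin0 !rising0 !mul1r.
rewrite big_nat_recl//= expr0 bin0 !rising0 mul1r divr1 mulr1.
have -> : \sum_(0 <= i < j.+1) (-1) ^+ i.+1 * ('C(j.+1, i.+1))%:R *
     (rising b i.+1 / rising c i.+1)
   = \sum_(0 <= i < j.+1) (-1) ^+ i.+1 * ('C(j, i.+1))%:R *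
       (rising b i.+1 / rising c i.+1)
     - b / c * \sum_(0 <= i < j.+1) (-1) ^+ i * ('C(j, i))%:R *
       (rising (b + 1) i / rising (c + 1) i).
  rewrite mulr_sumr -sumrB; apply: eq_bigr => i _.
  have h : rising (c + 1) i != 0 by rewrite gt_eqF// rising_gt0; lra.
  by rewrite binS natrD !risingSl exprS; field; rewrite h gt_eqF.
rewrite IHj; last lra.
have -> : c + 1 - (b + 1) = c - b by ring.
rewrite addrA.
have -> : 1 + \sum_(0 <= i < j.+1) (-1) ^+ i.+1 * ('C(j, i.+1))%:R *
       (rising b i.+1 / rising c i.+1) = rising (c - b) j / rising c j.
  rewrite -IHj// big_nat_recr//= bin_small// mulr0 mul0r addr0.
  by rewrite [in RHS]big_nat_recl//= expr0 bin0 !rising0 mul1r divr1 mulr1.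
have h : rising (c + 1) j != 0 by rewrite gt_eqF// rising_gt0; lra.
have h1 : rising c j != 0 by rewrite gt_eqF// rising_gt0.
have h2 : c + j%:R != 0 by rewrite gt_eqF// ltr_wpDr.
have -> : rising (c + 1) j = rising c j * (c + j%:R) / c.
  by rewrite -risingS risingSl; field; rewrite gt_eqF.
by rewrite !risingS; field; rewrite h1 h2 gt_eqF.
Qed.

Lemma rising_half_reflect (R : realType) (j : nat) :
  rising (1 / 2 - j%:R : R) j = (-1) ^+ j * rising (1 / 2) j.
Proof.
rewrite /rising (reindex_inj rev_ord_inj)/=.
have -> : (-1) ^+ j = \prod_(l < j) (-1) :> R by rewrite prodr_const card_ord.
rewrite -big_split/=; apply: eq_bigr => l _.
by rewrite natrB ?ltn_ord// -[in l.+1%:R]natr1; field.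
Qed.

(** The parameter for which the series terminates in degree j. *)
Definition step {R : realType} (k : R) (j : nat) : R :=
  (j%:R * (j%:R + k))^-1.

Lemma step_gt0 (R : realType) (k : R) (j : nat) : 0 <= k -> (0 < j)%N ->
  0 < step k j.
Proof.
move=> k0 j0; have : 0 < j%:R :> R by rewrite ltr0n.
by move=> h; rewrite invr_gt0 mulr_gt0// ltr_wpDr.
Qed.

Lemma damping_step (R : realType) (k : R) (j i : nat) : 0 <= k -> (0 < j)%N ->
  damping k (step k j) i = (j ^_ i)%:R * rising (j%:R + k) i * step k j ^+ i.
Proof.
move=> k0 j0; have hj : 0 < j%:R :> R by rewrite ltr0n.
have hjk : 0 < j%:R + k by rewrite ltr_wpDr.
elim: i => [|i IHi].
  by rewrite /damping big_ord0 rising0 expr0 ffactn0 !mulr1.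
rewrite dampingS IHi risingS exprS ffactnSr.
have [ij|ij] := leqP i j; last by rewrite ffact_small// !mul0r.
rewrite natrM natrB// /step; move: (_ ^+ i) (rising _ i) ((j ^_ i)%:R) => x y z.
by field; rewrite !gt_eqF.
Qed.

Lemma admissible_step (R : realType) (k : R) (j : nat) :
  0 <= k -> (0 < j)%N -> admissible k (step k j).
Proof.
move=> k0 j0; have hj : 0 < j%:R :> R by rewrite ltr0n.
have hd := step_gt0 k0 j0.
have d0 i : 0 <= damping k (step k j) i.
  rewrite damping_step// mulr_ge0 ?exprn_ge0 ?(ltW hd)// mulr_ge0//.
  by rewrite ltW// rising_gt0// ltr_wpDr.
elim=> [|i /andP[_ IHi]]; first by rewrite /damping big_ord0 ler01 lexx.
rewrite d0/= dampingS; apply: le_trans IHi; rewrite ler_piMr//.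
by rewrite gerBl mulr_ge0 ?(ltW hd)// mulr_ge0// addr_ge0.
Qed.

(** Here c - b = 1/2 - j in the Chu-Vandermonde identity, whence the reflected
    factor (1/2)_j. *)
Lemma hyp_endpoint (R : realType) (k : R) (j : nat) : 0 <= k -> (0 < j)%N ->
  hyp k (step k j) (step k j)^-1
    = (-1) ^+ j * (rising (1 / 2) j / rising (k + 1 / 2) j).
Proof.
move=> k0 j0; set d := step k j; have d0 : 0 < d by exact: step_gt0.
have hc : 0 < k + 1 / 2 by lra.
have <- : \sum_(0 <= i < j.+1) coef k d i * d^-1 ^+ i
    = (-1) ^+ j * (rising (1 / 2) j / rising (k + 1 / 2) j).
  rewrite mulrA -rising_half_reflect.
  have -> : 1 / 2 - j%:R = k + 1 / 2 - (j%:R + k) by ring.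
  rewrite -chu_vandermonde//; apply: eq_bigr => i _.
  rewrite /coef damping_step// -/d -bin_ffact natrM exprVn.
  have hr : rising (k + 1 / 2) i != 0 by rewrite gt_eqF// rising_gt0.
  have hf : (i`!%:R : R) != 0 by rewrite pnatr_eq0 -lt0n fact_gt0.
  have hd : d ^+ i != 0 by rewrite expf_neq0// gt_eqF.
  move: hr hf hd; move: (rising (k + 1 / 2) i) (i`!%:R : R) (d ^+ i).
  by move=> r f e hr hf he; field; rewrite hr hf he.
apply/cvg_lim => //; rewrite -(cvg_shiftn j.+1).
rewrite [X in X @ \oo](_ : _ =
  cst (\sum_(0 <= i < j.+1) coef k d i * d^-1 ^+ i)); first exact: cvg_cst.
apply/funext => n; rewrite /pseries /series /=.
rewrite (big_cat_nat (n := j.+1))//= ?leq_addl//.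
rewrite [X in _ + X]big_nat_cond [X in _ + X]big1 ?addr0// => i.
rewrite andbT => /andP[ji _].
by rewrite /coef damping_step// ffact_small// !(mul0r, mulr0).
Qed.

Lemma energy_endpoint (R : realType) (k : R) (j : nat) : 0 <= k -> (0 < j)%N ->
  energy k (step k j) (step k j)^-1
    = (j%:R * (j%:R + k)) `^ k * (rising (1 / 2) j / rising (k + 1 / 2) j) ^+ 2.
Proof.
move=> k0 j0; have d0 := step_gt0 k0 j0.
rewrite /energy hyp_endpoint// divff ?gt_eqF// subrr !(mulr0, mul0r) !addr0.
by rewrite exprMn -exprM mulnC exprM sqrrN expr1n expr1n mul1r invrK.
Qed.

Lemma step_cvg0 (R : realType) (k : R) : 0 <= k -> step k j @[j --> \oo] --> 0.
Proof.
move=> k0; rewrite /step; apply/gtr0_cvgV0.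
  near=> j; have hj : 0 < j%:R :> R.
    by rewrite ltr0n; near: j; exact: nbhs_infty_gt.
  by rewrite mulr_gt0// ltr_wpDr.
apply: (@ger_cvgy _ _ _ _ (fun j => j%:R)); last exact: cvgr_idn.
near=> j; have hj : 1 <= j%:R :> R.
  by rewrite ler1n; near: j; exact: nbhs_infty_gt.
by rewrite ler_peMr//; lra.
Unshelve. all: by end_near. Qed.

Lemma energy_step_cvg (R : realType) (k t : R) : 0 <= k <= 1 / 2 ->
  energy k (step k j) t @[j --> \oo] --> energy k 0 t.
Proof.
move=> hk; have k0 : 0 <= k by case/andP: hk.
have sc := step_cvg0 k0.
have hc : hyp k (step k j) t @[j --> \oo] --> hyp k 0 t.
  apply/cvgrPdist_le => e e0; near=> j.
  have j0 : (0 < j)%N by near: j; exact: nbhs_infty_gt.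
  have [h _] := hyp_sub_bound t hk (ltW (step_gt0 k0 j0))
    (admissible_step k0 j0).
  rewrite distrC; apply: (le_trans h).
  rewrite -ler_pdivlMr ?mulr_gt0 ?expR_gt0//.
  near: j; apply: (cvgr_le 0 sc).
  by rewrite divr_gt0// mulr_gt0// expR_gt0.
have dc : dhyp k (step k j) t @[j --> \oo] --> dhyp k 0 t.
  apply/cvgrPdist_le => e e0; near=> j.
  have j0 : (0 < j)%N by near: j; exact: nbhs_infty_gt.
  have [_ h] := hyp_sub_bound t hk (ltW (step_gt0 k0 j0))
    (admissible_step k0 j0).
  rewrite distrC; apply: (le_trans h).
  rewrite -ler_pdivlMr ?mulr_gt0 ?expR_gt0//.
  near: j; apply: (cvgr_le 0 sc).
  by rewrite divr_gt0// mulr_gt0// expR_gt0.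
have wc : 1 - step k j * t @[j --> \oo] --> 1 - 0 * t.
  by apply: cvgB; [exact: cvg_cst | apply: cvgM => //; exact: cvg_cst].
apply: cvgM; first exact: cvg_cst.
apply: cvgD; last first.
  by apply: cvgM; [apply: cvgM => //; exact: cvg_cst | exact: cvgM].
apply: cvgD; first exact: (cvgM hc hc).
apply: cvgM; last exact: (cvgM dc dc).
by apply: cvgM => //; exact: cvg_cst.
Unshelve. all: by end_near. Qed.

(** The comparison of [energy_compare], from a fixed t to the end point 1/d,
    passes to the limit d -> 0: on the left [energy_step_cvg], at the end point
    the hypothesis. *)
Lemma energy_bracket (R : realType) (k L : R) : 0 <= k <= 1 / 2 ->
  (j%:R * (j%:R + k)) `^ k * (rising (1 / 2) j / rising (k + 1 / 2) j) ^+ 2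
    @[j --> \oo] --> L ->
  (forall t, 1 <= t -> energy k 0 t * expR (- Num.sqrt t^-1) <= L
    <= energy k 0 t * expR (Num.sqrt t^-1)).
Proof.
move=> hk cL t t1; have k0 : 0 <= k by case/andP: hk.
have Ec := energy_step_cvg (t := t) hk.
have near_cmp : \forall j \near \oo,
  energy k (step k j) t * expR (- Num.sqrt t^-1) <=
  (j%:R * (j%:R + k)) `^ k * (rising (1 / 2) j / rising (k + 1 / 2) j) ^+ 2
  <= energy k (step k j) t * expR (Num.sqrt t^-1).
  near=> j; have j0 : (0 < j)%N by near: j; exact: nbhs_infty_gt.
  rewrite -energy_endpoint//; apply: energy_compare => //.
  - exact: admissible_step.
  - exact: step_gt0.
  - have t0 : 0 < t by lra.
    rewrite -[ltLHS]invrK ltf_pV2 ?posrE ?invr_gt0 ?step_gt0//; last first.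
      by rewrite -invr_gt0; exact: step_gt0.
    by near: j; apply: (cvgr_lt 0 (step_cvg0 k0)); rewrite invr_gt0; lra.
apply/andP; split.
  apply: (ler_cvg_to (cvgM Ec (cvg_cst _)) cL).
  by apply: filterS near_cmp => j /andP[].
apply: (ler_cvg_to cL (cvgM Ec (cvg_cst _))).
by apply: filterS near_cmp => j /andP[].
Unshelve. all: by end_near. Qed.

(** * The fundamental theorem of calculus on the half-line *)

(** Compact intervals that increase to the open half-line. *)
Definition exhaust {R : realType} (n : nat) : set R :=
  `[n.+1%:R^-1, n.+2%:R]%classic.

Lemma exhaustP (R : realType) (n : nat) (x : R) :
  exhaust n x -> 0 < x.
Proof.
by rewrite /exhaust/= in_itv/= => /andP[h _];
  apply: lt_le_trans h; rewrite invr_gt0.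
Qed.

Lemma exhaust_lt (R : realType) (n : nat) : n.+1%:R^-1 < n.+2%:R :> R.
Proof.
apply: (@le_lt_trans _ _ 1); first by rewrite invf_le1// ler1n.
by rewrite ltr1n.
Qed.

Lemma bigcup_exhaust (R : realType) :
  \bigcup_n @exhaust R n = `]0, +oo[%classic.
Proof.
apply/seteqP; split => [x [n _ /exhaustP]|x]/=; first by rewrite in_itv/= andbT.
rewrite in_itv/= andbT => x0; exists (Num.truncn x + Num.truncn x^-1)%N => //.
rewrite /exhaust/= in_itv/=; apply/andP; split.
  rewrite -[leRHS]invrK lef_pV2 ?posrE ?invr_gt0//.
  have := Num.Theory.truncnS_gt x^-1; move/ltW/le_trans; apply.
  by rewrite ler_nat ltnS leq_addl.
have := Num.Theory.truncnS_gt x; move/ltW/le_trans; apply.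
by rewrite ler_nat ltnS leqW// leq_addr.
Qed.

Lemma nondecreasing_exhaust (R : realType) : nondecreasing_seq (@exhaust R).
Proof.
move=> m n mn; rewrite subsetEset => x; rewrite /exhaust/= !in_itv/=.
move=> /andP[h1 h2]; apply/andP; split.
  by apply: le_trans h1; rewrite lef_pV2 ?posrE// ler_nat ltnS.
by apply: (le_trans h2); rewrite ler_nat !ltnS.
Qed.

Lemma continuous_within_pos (R : realType) (f : R -> R) (A : set R) :
  (forall x, A x -> 0 < x) -> (forall x : R, 0 < x -> {for x, continuous f}) ->
  {within A, continuous f}.
Proof.
move=> A0 cf; apply: continuous_in_subspaceT => x; rewrite inE => Ax.
exact/cf/A0.
Qed.

Lemma measurable_fun_pos (R : realType) (f : R -> R) :
  (forall x : R, 0 < x -> {for x, continuous f}) ->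
  measurable_fun (`]0, +oo[%classic : set R) f.
Proof.
move=> cf; apply: subspace_continuous_measurable_fun => //.
by apply: continuous_within_pos cf => x /=; rewrite in_itv/= andbT.
Qed.

Lemma FTC2_exhaust (R : realType) (F f : R -> R) (n : nat) :
  (forall x : R, 0 < x -> is_derive x 1 F (f x)) ->
  (forall x : R, 0 < x -> {for x, continuous f}) ->
  (\int[lebesgue_measure]_(x in exhaust n) (f x)%:E
    = (F n.+2%:R - F n.+1%:R^-1)%:E)%E.
Proof.
move=> dF cf.
have cF x : 0 < x -> {for x, continuous F}.
  move=> x0; apply: differentiable_continuous; apply/derivable1_diffP.
  by apply: ex_derive; exact: dF.
rewrite EFinB; apply: continuous_FTC2; first exact: exhaust_lt.
- by apply: continuous_within_pos cf => x; exact: exhaustP.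
- split.
  + move=> x xn; apply: ex_derive; apply: dF; move: xn; rewrite in_itv/=.
    by case/andP => h _; apply: lt_trans h; rewrite invr_gt0.
  + by apply: cvg_at_right_filter; apply: cF; rewrite invr_gt0.
  + by apply: cvg_at_left_filter; exact: cF.
- move=> x; rewrite in_itv/= => /andP[h _]; rewrite derive1E; apply: derive_val.
  by apply: dF; apply: lt_trans h; rewrite invr_gt0.
Qed.

Lemma cvg_exhaust_bounds (R : realType) (F : R -> R) (l0 l1 : R) :
  F x @[x --> 0^'+] --> l0 -> F x @[x --> +oo] --> l1 ->
  F n.+2%:R - F n.+1%:R^-1 @[n --> \oo] --> l1 - l0.
Proof.
move=> F0 F1; apply: cvgB.
  move/cvg_pinftyP : F1 => /(_ (fun n => n.+2%:R)); apply.
  apply: (@ger_cvgy _ _ _ _ (fun n => n%:R)); last exact: cvgr_idn.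
  by near=> n; rewrite ler_nat leqW.
move/cvg_at_rightP : F0 => /(_ (fun n => n.+1%:R^-1)); apply; split.
  by move=> n; rewrite invr_gt0.
apply/gtr0_cvgV0; first by near=> n.
apply: (@ger_cvgy _ _ _ _ (fun n => n%:R)); last exact: cvgr_idn.
by near=> n; rewrite ler_nat.
Unshelve. all: by end_near. Qed.

Lemma improper_FTC2_ge0 (R : realType) (F f : R -> R) (l0 l1 : R) :
  (forall x : R, 0 < x -> 0 <= f x) ->
  (forall x : R, 0 < x -> is_derive x 1 F (f x)) ->
  (forall x : R, 0 < x -> {for x, continuous f}) ->
  F x @[x --> 0^'+] --> l0 -> F x @[x --> +oo] --> l1 ->
  (\int[lebesgue_measure]_(x in `]0%R, +oo[) (f x)%:E = (l1 - l0)%:E)%E.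
Proof.
move=> f0 dF cf F0 F1.
have := @ge0_nondecreasing_set_cvg_integral _ (measurableTypeR R) R
  (@exhaust R) (EFin \o f) (@lebesgue_measure R) (@nondecreasing_exhaust R).
rewrite bigcup_exhaust => cI; apply/esym/(cvg_unique _ _ (cI _ _ _)) => //=.
- rewrite (_ : (fun _ => _) = (fun n => (F n.+2%:R - F n.+1%:R^-1)%:E)).
    by apply: cvg_EFin; [near=> n | exact: cvg_exhaust_bounds].
  by apply/funext => n; exact: FTC2_exhaust.
- by move=> n; exact: measurable_itv.
- move=> n; apply/measurable_EFinP; apply: measurable_funS (measurable_fun_pos cf).
    exact: measurable_itv.
  by move=> x /exhaustP; rewrite /= in_itv/= andbT.
- by move=> n x /exhaustP x0; rewrite lee_fin f0.
Unshelve. all: by end_near. Qed.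

Lemma improper_integrable_ge0 (R : realType) (F f : R -> R) (l0 l1 : R) :
  (forall x : R, 0 < x -> 0 <= f x) ->
  (forall x : R, 0 < x -> is_derive x 1 F (f x)) ->
  (forall x : R, 0 < x -> {for x, continuous f}) ->
  F x @[x --> 0^'+] --> l0 -> F x @[x --> +oo] --> l1 ->
  lebesgue_measure.-integrable `]0, +oo[ (EFin \o f).
Proof.
move=> f0 dF cf F0 F1; apply/integrableP; split.
  by apply/measurable_EFinP; exact: measurable_fun_pos.
rewrite (_ : (\int[_]_(_ in _) _)%E = (l1 - l0)%:E) ?ltry//.
rewrite -(improper_FTC2_ge0 f0 dF cf F0 F1); apply: eq_integral => x.
by rewrite inE/= in_itv/= andbT => x0; rewrite ger0_norm// f0.
Qed.

(** By dominated convergence, the integral is the limit of those over the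
    compact intervals [exhaust n]. *)
Lemma improper_FTC2 (R : realType) (F f : R -> R) (l0 l1 : R) :
  (forall x : R, 0 < x -> is_derive x 1 F (f x)) ->
  (forall x : R, 0 < x -> {for x, continuous f}) ->
  F x @[x --> 0^'+] --> l0 -> F x @[x --> +oo] --> l1 ->
  lebesgue_measure.-integrable `]0, +oo[ (EFin \o f) ->
  (\int[lebesgue_measure]_(x in `]0, +oo[) f x = l1 - l0)%R.
Proof.
move=> dF cf F0 F1 fi; rewrite /Rintegral.
have mD : measurable (`]0, +oo[%classic : set R) by exact: measurable_itv.
have mE n : measurable (@exhaust R n) by exact: measurable_itv.
have mf := measurable_fun_pos cf.
pose fn (n : nat) := (EFin \o f) \_ (exhaust n).
have mfn n : measurable_fun (`]0, +oo[%classic : set R) (fn n).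
  apply: measurable_funS (@measurableT _ _) _ _ => //.
  apply/(measurable_restrictT _ (mE n)); apply/measurable_EFinP.
  by apply: measurable_funS mf => // x /exhaustP; rewrite /= in_itv/= andbT.
have eD n : exhaust n `<=` (`]0, +oo[%classic : set R).
  by move=> x /exhaustP; rewrite /= in_itv/= andbT.
have mfE : measurable_fun (`]0, +oo[%classic : set R) (EFin \o f).
  exact/measurable_EFinP.
have fnf : {ae @lebesgue_measure R, forall x, `]0, +oo[%classic x ->
    fn n x @[n --> \oo] --> (EFin \o f) x}.
  apply: aeW => x; rewrite -bigcup_exhaust => -[N _ Nx].
  apply: cvg_near_cst; exists N => // n /= Nn; rewrite /fn patchE mem_set//.
  by have := @nondecreasing_exhaust R _ _ Nn; rewrite subsetEset; exact.
have fnle : {ae @lebesgue_measure R, forall x n, `]0, +oo[%classic x ->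
    (`|fn n x| <= (abse \o (EFin \o f)) x)%E}.
  apply: aeW => x n _; rewrite /fn patchE; case: ifPn => _ //=.
  by rewrite normr0 lee_fin.
have [_ _ cI] := @dominated_convergence _ (measurableTypeR R) R
  (@lebesgue_measure R) _ mD fn _ _ mfn mfE fnf (integrable_abse fi) fnle.
have {}cI : (F n.+2%:R - F n.+1%:R^-1)%:E @[n --> \oo]
    --> (\int[lebesgue_measure]_(x in `]0%R, +oo[) (f x)%:E)%E.
  apply: cvg_trans cI; apply: near_eq_cvg; near=> n => /=.
  rewrite -FTC2_exhaust// /fn -integral_mkcondr; congr (integral _ _ _).
  by apply/setIidPr; exact: eD.
suff -> : (\int[lebesgue_measure]_(x in `]0%R, +oo[) (f x)%:E = (l1 - l0)%:E)%E.
  by [].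
apply/esym/(cvg_unique _ _ cI) => //; apply: cvg_EFin; first by near=> n.
exact: cvg_exhaust_bounds.
Unshelve. all: by end_near. Qed.

(** * The Gamma function and the limit of the end-point energies *)

Definition gamma_integrand {R : realType} (x t : R) : R :=
  t `^ (x - 1) * expR (- t).

Lemma expR_ge_pow (R : realType) (n : nat) (t : R) : 0 <= t ->
  t ^+ n <= n`!%:R * expR t.
Proof.
move=> t0; case: n => [|n].
  by rewrite expr0 fact0 mul1r -expR0 ler_expR.
have h : 0 < (n.+1)`!%:R :> R by rewrite ltr0n fact_gt0.
by rewrite mulrC -ler_pdivrMr//; have := expR_ge1Dxn n t0; lra.
Qed.

Lemma powR_le_pow (R : realType) (x t : R) : 0 < x -> 0 < t ->
  t `^ x <= 1 + t ^+ (Num.truncn x).+1.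
Proof.
move=> x0 t0; have hx := ltW (Num.Theory.truncnS_gt x).
have [t1|t1] := leP t 1.
  apply: (@le_trans _ _ 1); last by rewrite lerDl exprn_ge0// ltW.
  by rewrite -(powRr0 t) ger_powR ?t0// ltW.
apply: (@le_trans _ _ (t ^+ (Num.truncn x).+1)); last by rewrite lerDr.
by rewrite -powR_mulrn ?(ltW t0)// ler_powR// ltW.
Qed.

(** Polynomial growth against the exponential; these two bounds dominate the
    Gamma integrand and kill the boundary term of the recurrence at infinity.
    *)
Lemma powR_le_expR (R : realType) (x : R) : 0 < x ->
  exists2 C : R, 0 < C & forall t : R, 0 < t ->
    (1 + t `^ x) ^+ 2 <= C * expR t /\ t `^ x * t <= C * expR t.
Proof.
move=> x0; set N := (Num.truncn x).+1.
(* From (1 + t^x)^2 <= (2 + t^N)^2 <= 8 + 2 t^(2N) and t^(1+x) <= t + t^(N+1). *)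
exists (8 + 2 * (N * 2)`!%:R + N.+1`!%:R).
  by rewrite ltr_wpDr// ltr_wpDr// mulr_ge0.
move=> t t0; have h := powR_le_pow x0 t0; rewrite -/N in h.
have p0 := powR_ge0 t x; have e1 : 1 <= expR t by rewrite -expR0 ler_expR ltW.
have h1 := expR_ge_pow (N * 2) (ltW t0); have h2 := expR_ge_pow N.+1 (ltW t0).
have h3 : t <= expR t by have := expR_ge1Dx t; lra.
have f1 : 0 <= (N * 2)`!%:R :> R by [].
have f2 : 0 <= N.+1`!%:R :> R by [].
rewrite exprM in h1; rewrite exprS in h2.
have q0 : 0 <= t ^+ N by rewrite exprn_ge0// ltW.
move: h h1 h2 q0; set q := t ^+ N => h h1 h2 q0.
rewrite !mulrDl; split; last first.
  have h4 : t `^ x * t <= (1 + q) * t by rewrite ler_wpM2r// ltW.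
  have h5 : 0 <= (N * 2)`!%:R * expR t by rewrite mulr_ge0// expR_ge0.
  lra.
have h4 : (1 + t `^ x) ^+ 2 <= (2 + q) ^+ 2.
  by rewrite ler_sqr ?nnegrE ?addr_ge0//; lra.
have h5 : 0 <= N.+1`!%:R * expR t by rewrite mulr_ge0// expR_ge0.
have h6 : (2 + q) ^+ 2 <= 8 + 2 * q ^+ 2 by have := sqr_ge0 (q - 2); nra.
lra.
Qed.

Lemma continuous_powR (R : realType) (x t : R) : 0 < t ->
  {for t, continuous (fun t => t `^ x)}.
Proof.
move=> t0; apply: differentiable_continuous; apply/derivable1_diffP.
by apply: ex_derive; exact: is_derive1_powR.
Qed.

Lemma continuous_gamma_integrand (R : realType) (x t : R) : 0 < t ->
  {for t, continuous (gamma_integrand x)}.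
Proof.
move=> t0; apply: cvgM; first exact: continuous_powR.
apply: (@continuous_comp _ _ _ (fun t : R => - t) expR).
  exact: opp_continuous.
exact: continuous_expR.
Qed.

Lemma powR_cvgy (R : realType) (x : R) : 0 < x -> t `^ x @[t --> +oo] --> +oo.
Proof.
move=> x0; apply/cvgryPge => A; near=> t.
have t0 : 0 < t by near: t; exact: nbhs_pinfty_gt.
have [A0|A0] := leP A 0; first exact: le_trans (powR_ge0 _ _).
have -> : A = (A `^ x^-1) `^ x.
  by rewrite -powRrM mulVf ?gt_eqF// powRr1// ltW.
apply: ge0_ler_powR; rewrite ?nnegrE ?powR_ge0 ?(ltW x0) ?(ltW t0)//.
Unshelve. all: by end_near. Qed.

Lemma powRB1 (R : realType) (x t : R) : 0 < t -> t `^ (x - 1) = t `^ x / t.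
Proof.
by move=> t0; rewrite powRB ?powRr1 ?(ltW t0)// (gt_eqF t0) implybT.
Qed.

(** The integrand is dominated by the derivative of (-C/x) / (1 + t^x), for a
    suitable constant C. *)
Lemma Gamma_integrable (R : realType) (x : R) : 0 < x ->
  lebesgue_measure.-integrable `]0, +oo[ (EFin \o gamma_integrand x).
Proof.
move=> x0; have [C C0 hC] := powR_le_expR x0.
pose F (t : R) := - (C / x) * (1 + t `^ x)^-1.
pose f (t : R) := C * t `^ (x - 1) / (1 + t `^ x) ^+ 2.
have pos (t : R) : 0 < 1 + t `^ x :> R by rewrite ltr_pwDl// powR_ge0.
have dF (t : R) : 0 < t -> is_derive t 1 F (f t).
  move=> t0; have d1 := is_derive1_powR x t0.
  have d2 : is_derive t 1 (fun t : R => 1 + t `^ x) (x * t `^ (x - 1)).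
    apply: (@is_derive_eq _ _ _ _ _ _ _ _
      (is_deriveD (is_derive_cst (1 : R) t 1) d1)).
    by rewrite add0r.
  have d3 : is_derive t 1 (fun t : R => (1 + t `^ x)^-1)
      (- (1 + t `^ x) ^- 2 *: (x * t `^ (x - 1))).
    by apply: is_deriveV; rewrite gt_eqF.
  apply: (@is_derive_eq _ _ _ _ _ _ _ _ (is_deriveZ _ d3)).
  rewrite /f /GRing.scale/=; have := pos t; move: (1 + t `^ x) => y y0.
  by field; rewrite !gt_eqF.
have cf (t : R) : 0 < t -> {for t, continuous f}.
  move=> t0; apply: cvgM; first apply: cvgM; first exact: cvg_cst.
    exact: continuous_powR.
  apply: cvgV; first by rewrite expf_neq0// gt_eqF.
  by apply: cvgM; (apply: cvgD; [exact: cvg_cst | exact: continuous_powR]).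
have F0 : F t @[t --> 0^'+] --> - (C / x) * (1 + 0)^-1.
  apply: cvgM; first exact: cvg_cst.
  apply: cvgV; first by rewrite addr0.
  by apply: cvgD; [exact: cvg_cst | exact: powR_cvg0].
have F1 : F t @[t --> +oo] --> - (C / x) * 0.
  apply: cvgM; first exact: cvg_cst.
  apply/gtr0_cvgV0; first by near=> t.
  apply: (@ger_cvgy _ _ _ _ (fun t => t `^ x)); last exact: powR_cvgy.
  by near=> t; rewrite lerDr.
have f0 (t : R) : 0 < t -> 0 <= f t.
  by move=> t0; rewrite divr_ge0 ?mulr_ge0 ?powR_ge0 ?sqr_ge0// ltW.
have mD : measurable (`]0, +oo[%classic : set R) by exact: measurable_itv.
have gi := improper_integrable_ge0 f0 dF cf F0 F1.
apply: (@le_integrable _ (measurableTypeR R) R (@lebesgue_measure R) _ mD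
  _ _ _ _ gi).
  apply/measurable_EFinP; apply: measurable_fun_pos => t.
  exact: continuous_gamma_integrand.
move=> t; rewrite /= in_itv/= andbT => t0; rewrite lee_fin.
rewrite (ger0_norm (f0 _ t0)) ger0_norm ?mulr_ge0 ?powR_ge0 ?expR_ge0//.
rewrite /gamma_integrand /f expRN [C * _]mulrC -mulrA ler_wpM2l ?powR_ge0//.
rewrite ler_pdivlMr ?exprn_gt0// mulrC ler_pdivrMr ?expR_gt0//.
by have [] := hC t t0.
Unshelve. all: by end_near. Qed.

(** Integration of the derivative of t^x exp(-t). *)
Lemma GammaS (R : realType) (x : R) : 0 < x -> Gamma (x + 1) = x * Gamma x.
Proof.
move=> x0; have [C C0 hC] := powR_le_expR x0.
have x1 : 0 < x + 1 by lra.
have mD : measurable (`]0, +oo[%classic : set R) by exact: measurable_itv.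
pose F (t : R) := t `^ x * expR (- t).
pose f (t : R) := x * gamma_integrand x t - gamma_integrand (x + 1) t.
have xgi : lebesgue_measure.-integrable (`]0, +oo[%classic : set R)
    (EFin \o (fun t => x * gamma_integrand x t)).
  have := @integrableZl _ (measurableTypeR R) R (@lebesgue_measure R) _
    mD x _ (Gamma_integrable x0).
  by congr (_.-integrable _ _); apply/funext => t.
have cf (t : R) : 0 < t -> {for t, continuous f}.
  move=> t0; apply: cvgB; last exact: continuous_gamma_integrand.
  by apply: cvgM; [exact: cvg_cst | exact: continuous_gamma_integrand].
have dF (t : R) : 0 < t -> is_derive t 1 F (f t).
  move=> t0; have d1 := is_derive1_powR x t0.
  have d2 : is_derive t 1 (fun t => - t : R) (- 1) by exact: is_deriveNid.
  have d3 := @is_derive1_comp _ expR (fun t => - t) t _ _ (is_derive_expR _) d2.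
  apply: (@is_derive_eq _ _ _ _ _ _ _ _ (is_deriveM d1 d3)).
  by rewrite /f /gamma_integrand /GRing.scale/= addrK; ring.
have F0 : F t @[t --> 0^'+] --> 0 * expR (- 0).
  apply: cvgM; first exact: powR_cvg0.
  apply: cvg_at_right_filter.
  apply: (@continuous_comp _ _ _ (fun t : R => - t) expR).
    exact: opp_continuous.
  exact: continuous_expR.
have F1 : F t @[t --> +oo] --> 0.
  apply: (@squeeze_cvgr _ _ _ _ (cst 0) (fun t => C * t^-1)).
  - near=> t; have t0 : 0 < t by near: t; exact: nbhs_pinfty_gt.
    rewrite mulr_ge0 ?powR_ge0 ?expR_ge0//= /F expRN ler_pdivrMr ?expR_gt0//.
    rewrite mulrAC ler_pdivlMr//; by have [] := hC t t0.
  - exact: cvg_cst.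
  - rewrite -[X in _ --> X](mulr0 C); apply: cvgM; first exact: cvg_cst.
    apply/gtr0_cvgV0; last exact: cvg_id.
    by near=> t; near: t; exact: nbhs_pinfty_gt.
have fi : lebesgue_measure.-integrable (`]0, +oo[%classic : set R) (EFin \o f).
  have := @integrableB _ (measurableTypeR R) R (@lebesgue_measure R) _
    mD _ _ xgi (Gamma_integrable x1).
  by congr (_.-integrable _ _); apply/funext => t.
have := improper_FTC2 dF cf F0 F1 fi.
rewrite mul0r subrr /f RintegralB//; last exact: Gamma_integrable.
rewrite RintegralZl//; last exact: Gamma_integrable.
by move/eqP; rewrite subr_eq0 => /eqP/esym.
Unshelve. all: by end_near. Qed.

(** Twice the Gaussian integral over [0, sqrt t] is a primitive of the
    integrand. *)
Lemma Gamma_half (R : realType) : Gamma (1 / 2) = Num.sqrt pi :> R.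
Proof.
pose I := @gauss_integral_proof.integral0_gauss R.
have gi (x : R) : lebesgue_measure.-integrable `[0, x] (EFin \o @gauss_fun R).
  apply: continuous_compact_integrable; first exact: segment_compact.
  by apply: continuous_subspaceT; exact: continuous_gauss_fun.
have dI (x : R) : 0 < x -> is_derive x 1 I (gauss_fun x).
  move=> x0; have x1 : x < x + 1 by rewrite ltrDl.
  have [d1 d2] : derivable I x 1 /\ derive1 I x = gauss_fun x.
    exact: (continuous_FTC1_closed x1 (gi _) x0 (@continuous_gauss_fun R x)).
  by apply: DeriveDef; [exact: d1 | rewrite -derive1E].
have I0 (x : R) : 0 < x -> 0 <= I x <= x.
  move=> x0; rewrite gauss_integral_proof.integral0_gauss_ge0/=.
  apply: (@le_trans _ _ (\int[@lebesgue_measure R]_(t in `[0, x]) 1)).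
    apply: (@le_Rintegral _ (measurableTypeR R) R (@lebesgue_measure R)).
    - exact: measurable_itv.
    - exact: gi.
    - apply: continuous_compact_integrable; first exact: segment_compact.
      by move=> z; exact: cvg_cst.
    - by move=> t _; exact: gauss_fun_le1.
  rewrite Rintegral_cst//= mul1r lebesgue_measure_itv/= lte_fin x0/=.
  by rewrite subr0.
have Iy : I x @[x --> +oo] --> Num.sqrt pi / 2.
  have : Num.sqrt (I x ^+ 2) @[x --> +oo] --> Num.sqrt (pi / 4).
    apply: continuous_cvg; first exact: sqrt_continuous.
    exact: gauss_integral_proof.cvg_integral0_gauss_sqr.
  rewrite sqrtrM ?pi_ge0// sqrtrV// (_ : 4 = 2 ^+ 2) ?sqrtr_sqr ?ger0_norm//;
    last ring.
  rewrite (_ : (fun _ => Num.sqrt _) = I)//; apply/funext => r.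
  by rewrite sqrtr_sqr ger0_norm// gauss_integral_proof.integral0_gauss_ge0.
pose F (t : R) := 2 * I (Num.sqrt t).
have dF (t : R) : 0 < t -> is_derive t 1 F (gamma_integrand (1 / 2) t).
  move=> t0; have s0 : 0 < Num.sqrt t by rewrite sqrtr_gt0.
  have d1 := is_derive1_comp (dI _ s0) (is_derive1_sqrt t0).
  apply: (@is_derive_eq _ _ _ _ _ _ _ _ (is_deriveZ _ d1)).
  rewrite /gamma_integrand /gauss_fun sqr_sqrtr ?ltW// powRB1//.
  rewrite div1r powR12_sqrt ?ltW// /GRing.scale/=.
  have -> : Num.sqrt t / t = (Num.sqrt t)^-1.
    by rewrite -{2}(sqr_sqrtr (ltW t0)); field; rewrite gt_eqF.
  by field; rewrite gt_eqF.
have F0 : F t @[t --> 0^'+] --> (2 * 0 : R).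
  apply: cvgM; first exact: cvg_cst.
  apply: (@squeeze_cvgr _ _ _ _ (cst 0) Num.sqrt).
  - near=> t; have t0 : 0 < t by near: t; exact: nbhs_right_gt.
    by apply: I0; rewrite sqrtr_gt0.
  - exact: cvg_cst.
  - rewrite -[X in _ --> X](@sqrtr0 R).
    by apply: cvg_at_right_filter; exact: sqrt_continuous.
have F1 : F t @[t --> +oo] --> (2 * (Num.sqrt pi / 2) : R).
  apply: cvgM; first exact: cvg_cst.
  apply: (@cvg_comp _ _ _ Num.sqrt I _ +oo); last exact: Iy.
  apply/cvgryPge => A; near=> t.
  have [A0|A0] := leP A 0; first exact: le_trans (sqrtr_ge0 _).
  rewrite -[leLHS](ger0_norm (ltW A0)) -sqrtr_sqr ler_wsqrtr//.
have h0 : 0 < 1 / 2 :> R by lra.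
have h := improper_FTC2 dF (@continuous_gamma_integrand R (1 / 2)) F0 F1
  (Gamma_integrable h0).
by rewrite /Gamma h mulr0 subr0; field.
Unshelve. all: by end_near. Qed.

Lemma Gamma_ge0 (R : realType) (x : R) : 0 <= Gamma x.
Proof. by apply: Rintegral_ge0 => t _; rewrite mulr_ge0 ?powR_ge0 ?expR_ge0. Qed.

(** Young's inequality for the conjugate exponents 1/s and 1/(1-s). *)
Lemma bernoulli_powR (R : realType) (u s : R) : 0 < u -> 0 <= s <= 1 ->
  u `^ s <= 1 - s + s * u.
Proof.
move=> u0 /andP[]; rewrite le_eqVlt => /predU1P[<-|s0].
  by rewrite powRr0 => _; lra.
rewrite le_eqVlt => /predU1P[->|s1].
  by rewrite powRr1 ?(ltW u0)// mul1r subrr add0r.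
have := @conjugate_powR _ (u `^ s) 1 s^-1 (1 - s)^-1.
rewrite powR_ge0 !invr_gt0 subr_gt0 !invrK mulr1 powR1 -powRrM divff ?gt_eqF//.
rewrite powRr1 ?(ltW u0)// addrC subrK => h.
by have := h isT ler01 s0 s1 erefl; lra.
Qed.

(** Wendel's inequality: Bernoulli's inequality for (t/x)^s inside the
    integral, then the recurrence. *)
Lemma Gamma_wendel (R : realType) (x s : R) : 0 < x -> 0 <= s <= 1 ->
  Gamma (x + s) <= x `^ s * Gamma x.
Proof.
move=> x0 hs; have xs : 0 < x + s by case/andP: hs; lra.
have x1 : 0 < x + 1 by lra.
have mD : measurable (`]0, +oo[%classic : set (measurableTypeR R)).
  exact: measurable_itv.
pose f (t : R) := x `^ s * (1 - s) * gamma_integrand x t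
  + x `^ s * s / x * gamma_integrand (x + 1) t.
have i1 (c y : R) : 0 < y -> lebesgue_measure.-integrable
    (`]0, +oo[%classic : set R) (EFin \o (fun t => c * gamma_integrand y t)).
  move=> y0; exact: (@integrableZl _ (measurableTypeR R) R (@lebesgue_measure R)
    _ mD c _ (Gamma_integrable y0)).
have fi : lebesgue_measure.-integrable (`]0, +oo[%classic : set R) (EFin \o f).
  exact: (@integrableD _ (measurableTypeR R) R (@lebesgue_measure R)
    _ mD _ _ (i1 _ _ x0) (i1 _ _ x1)).
apply: (@le_trans _ _ (\int[@lebesgue_measure R]_(t in `]0, +oo[) f t)).
  apply: (@le_Rintegral _ (measurableTypeR R) R (@lebesgue_measure R) _
    _ _ mD (Gamma_integrable xs) fi) => t.
  rewrite /= in_itv/= andbT => t0; rewrite /f /gamma_integrand addrK !powRB1//.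
  rewrite powRD ?(gt_eqF t0) ?implybT//.
  have tx : 0 < t / x by rewrite divr_gt0.
  have -> : t `^ s = x `^ s * (t / x) `^ s.
    rewrite -powRM; [|exact: ltW|exact: ltW].
    by congr (_ `^ _); field; rewrite gt_eqF.
  have := bernoulli_powR tx hs; move: ((t / x) `^ s) => u hu.
  have q0 : 0 <= t `^ x / t * x `^ s * expR (- t).
    by rewrite !mulr_ge0 ?powR_ge0 ?expR_ge0// invr_ge0 ltW.
  have := ler_wpM2l q0 hu.
  move: (t `^ x) (x `^ s) (expR (- t)) => p y e.
  have -> : p / t * y * e * u = p * (y * u) / t * e by field; rewrite gt_eqF.
  move=> h; apply: (le_trans h); rewrite le_eqVlt; apply/orP; left; apply/eqP.
  by field; rewrite !gt_eqF.
rewrite (@RintegralD _ (measurableTypeR R) R (@lebesgue_measure R) _ _ _ mD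
  (i1 _ _ x0) (i1 _ _ x1)).
rewrite !(@RintegralZl _ (measurableTypeR R) R (@lebesgue_measure R) _ _ _ mD);
  [|exact: Gamma_integrable..].
have -> : \int[@lebesgue_measure R]_(t in `]0, +oo[) gamma_integrand x t = Gamma x.
  by [].
have -> : \int[@lebesgue_measure R]_(t in `]0, +oo[) gamma_integrand (x + 1) t
   = Gamma (x + 1) by [].
rewrite GammaS// le_eqVlt; apply/orP; left; apply/eqP.
by field; rewrite gt_eqF.
Qed.

Lemma rising_Gamma (R : realType) (x : R) (j : nat) : 0 < x ->
  Gamma (x + j%:R) = rising x j * Gamma x.
Proof.
move=> x0; elim: j => [|j IHj]; first by rewrite addr0 rising0 mul1r.
rewrite -natr1 addrA GammaS; last by rewrite ltr_wpDr.
by rewrite IHj risingS; ring.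
Qed.

(** If Gamma vanished at x, Wendel's inequality and the recurrence would make
    it vanish on the whole half-line to the right of x, which contains points
    1/2 + n. *)
Lemma Gamma_gt0 (R : realType) (x : R) : 0 < x -> 0 < Gamma x.
Proof.
move=> x0; have := Gamma_ge0 x; rewrite le_eqVlt => /predU1P[G0|//].
pose n := (Num.truncn x).+1; have nx : x < n%:R by exact: Num.Theory.truncnS_gt.
pose r := 1 / 2 + n%:R - x; have r0 : 0 <= r by rewrite /r; lra.
pose m := Num.truncn r; have /andP[mr rm] := Num.Theory.truncn_itv r0.
have hs : 0 <= r - m%:R <= 1 by move: mr rm; rewrite -/m -natr1; lra.
have Gs : Gamma (x + (r - m%:R)) = 0.
  apply/eqP; rewrite eq_le Gamma_ge0 andbT.
  by have := Gamma_wendel x0 hs; rewrite -G0 mulr0.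
have xs : 0 < x + (r - m%:R) by case/andP: hs; lra.
have := rising_Gamma m xs; rewrite Gs mulr0.
have -> : x + (r - m%:R) + m%:R = 1 / 2 + n%:R by rewrite /r; ring.
rewrite rising_Gamma ?Gamma_half; last lra.
move/eqP; rewrite mulf_eq0 !gt_eqF ?sqrtr_gt0 ?pi_gt0// rising_gt0//; lra.
Qed.

(** With X = j + 1/2 the j-th term is Gamma(c)^2 / pi times the square of X^k
    Gamma(X) / Gamma(X+k), which tends to 1 by Wendel's inequality applied with
    the exponents k and 1 - k, times (j(j+k)/X^2)^k. *)
Lemma endpoint_energy_cvg (R : realType) (k : R) : 0 <= k <= 1 / 2 ->
  (j%:R * (j%:R + k)) `^ k * (rising (1 / 2) j / rising (k + 1 / 2) j) ^+ 2
    @[j --> \oo] --> Gamma (k + 1 / 2) ^+ 2 / pi.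
Proof.
move=> /andP[k0 k1]; have hk : 0 <= k <= 1 by apply/andP; split => //; lra.
have hk' : 0 <= 1 - k <= 1 by apply/andP; split; lra.
have hc : 0 < k + 1 / 2 by lra.
have h2 : 0 < 1 / 2 :> R by lra.
pose X (j : nat) : R := j%:R + 1 / 2.
have X0 j : 0 < X j by rewrite /X ltr_wpDl.
have XE j : X j = j%:R + 1 / 2 by [].
clearbody X.
pose rho j := X j `^ k * (Gamma (X j) / Gamma (X j + k)).
have Vc : (X j)^-1 @[j --> \oo] --> (0 : R).
  apply/gtr0_cvgV0; first by near=> j.
  apply: (@ger_cvgy _ _ _ _ (fun j => j%:R)); last exact: cvgr_idn.
  by near=> j; rewrite XE lerDl ltW.
have rhoc : rho j @[j --> \oo] --> (1 : R).
  apply: (@squeeze_cvgr _ _ _ _ (cst 1) (fun j => 1 + k * (X j)^-1)).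
  - near=> j; have x0 := X0 j; have xk : 0 < X j + k by lra.
    have := Gamma_gt0 xk; have := Gamma_wendel x0 hk.
    have := Gamma_wendel xk hk'.
    have -> : X j + k + (1 - k) = X j + 1 by ring.
    rewrite GammaS// /rho; move: (Gamma (X j)) (Gamma (X j + k)).
    move=> u v h huv v0; apply/andP; split.
      by rewrite mulrA ler_pdivlMr// mul1r.
    have b : ((X j + k) / X j) `^ (1 - k) <= (X j + k) / X j.
      rewrite ler1_powR//; last lra.
      by rewrite ler_pdivlMr// mul1r; lra.
    have -> : 1 + k / X j = (X j + k) / X j by field; rewrite gt_eqF.
    apply: le_trans b; rewrite mulrA ler_pdivrMr//.
    have hV : (X j)^-1 `^ (1 - k) = X j `^ k / X j.
      by rewrite -[in LHS]powR_inv1 ?(ltW x0)// -powRrM mulN1r opprB powRB1.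
    rewrite powRM ?invr_ge0 ?(ltW x0) ?(ltW xk)// hV.
    have := ler_wpM2r (_ : 0 <= X j `^ k / X j) h.
    rewrite divr_ge0 ?powR_ge0 ?(ltW x0)// => /(_ isT) {}h.
    have -> : X j `^ k * u = X j * u * (X j `^ k / X j).
      by field; rewrite gt_eqF.
    by apply: (le_trans h); rewrite mulrAC.
  - exact: cvg_cst.
  - suff : 1 + k * (X j)^-1 @[j --> \oo] --> (1 + k * 0 : R).
      by rewrite mulr0 addr0.
    by apply: cvgD; [exact: cvg_cst | apply: cvgM => //; exact: cvg_cst].
(* The quotient j(j+k) / X^2, written with j = X - 1/2. *)
pose q j := (1 - 1 / 2 * (X j)^-1) * (1 + (k - 1 / 2) * (X j)^-1).
have qc : q j @[j --> \oo] --> (1 : R).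
  suff : q j @[j --> \oo] --> ((1 - 1 / 2 * 0) * (1 + (k - 1 / 2) * 0) : R).
    by rewrite !mulr0 subr0 addr0 mulr1.
  apply: cvgM.
    by apply: cvgB; [exact: cvg_cst | apply: cvgM => //; exact: cvg_cst].
  by apply: cvgD; [exact: cvg_cst | apply: cvgM => //; exact: cvg_cst].
have qkc : q j `^ k @[j --> \oo] --> (1 : R).
  suff : q j `^ k @[j --> \oo] --> (1 `^ k : R) by rewrite powR1.
  exact: (continuous_cvg _ (@continuous_powR R k 1 ltr01) qc).
have main : rho j ^+ 2 * q j `^ k * (Gamma (k + 1 / 2) ^+ 2 / pi) @[j --> \oo]
    --> 1 ^+ 2 * 1 * (Gamma (k + 1 / 2) ^+ 2 / pi).
  apply: cvgM; last exact: cvg_cst.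
  by apply: cvgM => //; exact: (cvgM rhoc rhoc).
have <- : 1 ^+ 2 * 1 * (Gamma (k + 1 / 2) ^+ 2 / pi)
    = Gamma (k + 1 / 2) ^+ 2 / pi :> R by ring.
apply: cvg_trans main; apply: near_eq_cvg; near=> j.
have j0 : 0 < j%:R :> R by rewrite ltr0n; near: j; exact: nbhs_infty_gt.
have x0 := X0 j; have xk : 0 < X j + k by lra.
have hq : j%:R * (j%:R + k) = X j * X j * q j.
  rewrite /q; have -> : j%:R = X j - 1 / 2 by rewrite XE; ring.
  by field; rewrite gt_eqF.
have q0 : 0 < q j.
  have : 0 < X j * X j * q j by rewrite -hq mulr_gt0//; lra.
  by rewrite pmulr_rgt0// mulr_gt0.
have hn : rising (1 / 2) j = Gamma (X j) / Num.sqrt pi.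
  rewrite XE addrC rising_Gamma// Gamma_half mulfK// gt_eqF// sqrtr_gt0.
  exact: pi_gt0.
have hd : rising (k + 1 / 2) j = Gamma (X j + k) / Gamma (k + 1 / 2).
  have -> : X j + k = k + 1 / 2 + j%:R by rewrite XE; ring.
  by rewrite rising_Gamma// mulfK// gt_eqF// Gamma_gt0.
have hp : (j%:R * (j%:R + k)) `^ k = X j `^ k * X j `^ k * q j `^ k.
  rewrite hq powRM; [|by rewrite mulr_ge0 // ltW|exact: ltW].
  by rewrite powRM//; exact: ltW.
rewrite hp hn hd /rho.
have gc := Gamma_gt0 hc; have gk := Gamma_gt0 xk.
have sp : 0 < Num.sqrt (pi : R) by rewrite sqrtr_gt0 pi_gt0.
rewrite -{1}(sqr_sqrtr (pi_ge0 R)).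
move: gc gk; move: (Gamma (X j)) (Gamma (k + 1 / 2)) (Gamma (X j + k)).
by move=> u v w v0 w0; field; rewrite !gt_eqF.
Unshelve. all: by end_near. Qed.

(** * Zeros of the derivative of the Bessel series *)

(** The function t (g^2 + t g'^2) has derivative g^2 + (1-2k) t g'^2 >= 0; if
    it vanished at t it would vanish on [0, t], contradicting g(0) = 1. *)
Lemma hyp_no_double_zero (R : realType) (k t : R) : 0 <= k <= 1 / 2 -> 0 < t ->
  dhyp k 0 t = 0 -> hyp k 0 t != 0.
Proof.
move=> /andP[k0 k1] t0 ht; apply/eqP => gt.
have adm := admissible0 k.
pose W (s : R) := s * (hyp k 0 s ^+ 2 + s * dhyp k 0 s ^+ 2).
have dW (s : R) : is_derive s 1 W
    (hyp k 0 s ^+ 2 + (1 - 2 * k) * (s * dhyp k 0 s ^+ 2)).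
  have hg := is_derive_hyp s k0 adm; have hh := is_derive_dhyp s k0 adm.
  apply: is_derive_eq; rewrite /GRing.scale/=.
  have := hyp_ode s k0 adm.
  rewrite mul0r subr0 mulr1 mulr0 mul0r subr0.
  move: (hyp k 0 s) (dhyp k 0 s) (ddhyp k 0 s) => g h h2 ode.
  apply: (@etrans _ _ (g ^+ 2 + (1 - 2 * k) * (s * h ^+ 2)
    + 2 * s * h * (s * h2 + (k + 1 / 2) * h + g))).
    by field.
  by rewrite ode mulr0 addr0.
have Wmono : {in `[0, t] &, {homo W : x y / x <= y}}.
  apply: (@ger0_derive1_le_cc _ W 0 t).
  - by move=> s _; apply: ex_derive; exact: dW.
  - move=> s; rewrite in_itv/= => /andP[s0 _].
    rewrite derive1E (@derive_val _ _ _ _ _ _ _ (dW s)).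
    have h2 : 0 <= 1 - 2 * k by lra.
    apply: addr_ge0; first exact: sqr_ge0.
    by apply: mulr_ge0 => //; apply: mulr_ge0; [exact: ltW | exact: sqr_ge0].
  - apply: derivable_within_continuous => s _; apply: ex_derive; exact: dW.
have Wt : W t = 0 by rewrite /W gt ht expr0n/= !mulr0 addr0 mulr0.
have g0 (s : R) : 0 < s -> s <= t -> hyp k 0 s = 0.
  move=> s0 st; have : W s <= 0.
    by rewrite -Wt Wmono// in_itv/= ?lexx ?st ?andbT ltW.
  rewrite /W pmulr_rle0// => h; apply/eqP; rewrite -sqrf_eq0 eq_le sqr_ge0 andbT.
  by apply: le_trans h; rewrite lerDl mulr_ge0 ?sqr_ge0// ltW.
have : hyp k 0 s @[s --> 0^'+] --> hyp k 0 0.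
  apply: cvg_at_right_filter; apply: differentiable_continuous.
  by apply/derivable1_diffP; apply: ex_derive; exact: is_derive_hyp.
have : hyp k 0 s @[s --> 0^'+] --> (0 : R).
  apply: cvg_near_cst; near=> s; apply: g0.
    by near: s; exact: nbhs_right_gt.
  by near: s; exact: nbhs_right_le.
move=> c1 c2; have : 0 = hyp k 0 0 :> R by apply: (cvg_unique _ c1 c2).
by rewrite hyp0 => /eqP; rewrite eq_sym oner_eq0.
Unshelve. all: by end_near. Qed.

Lemma nonincreasing_from (R : realType) (f df : R -> R) (t1 t : R) :
  (forall s : R, t1 <= s -> is_derive s 1 f (df s)) ->
  (forall s, t1 <= s -> df s <= 0) -> t1 <= t -> f t <= f t1.
Proof.
move=> hf hdf t1t; rewrite -subr_le0.
have [||c ct ->] := @MVT_segment _ f df t1 t t1t.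
- by move=> x; rewrite in_itv/= => /andP[h _]; apply: hf; exact: ltW.
- apply: derivable_within_continuous => s; rewrite in_itv/= => /andP[h _].
  by apply: ex_derive; exact: hf.
- move: ct; rewrite in_itv/= => /andP[h _].
  by rewrite mulr_le0_ge0 ?subr_ge0// hdf.
Qed.

(** Suppose b > 0 beyond T; then a decreases. If a becomes negative, (t^c b)' =
    t^(c-1) a drives t^c b to minus infinity. Otherwise t^c b increases, so b
    >= p t^(-c) for some p > 0, and as c < 1 this drives a to minus infinity.
    *)
Lemma no_eventual_sign (R : realType) (a b : R -> R) (c T : R) :
  0 < c < 1 -> 0 < T ->
  (forall t : R, T < t -> is_derive t 1 a (- b t)) ->
  (forall t : R, T < t -> is_derive t 1 b ((a t - c * b t) / t)) ->
  ~ (forall t, T < t -> 0 < b t).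
Proof.
move=> /andP[c0 c1] T0 da db b0.
have dP (t : R) : T < t ->
    is_derive t 1 (fun t => t `^ c * b t) (t `^ c / t * a t).
  move=> Tt; have t0 : 0 < t by exact: lt_trans Tt.
  have d1 := is_derive1_powR c t0; have d2 := db t Tt.
  apply: (@is_derive_eq _ _ _ _ _ _ _ _ (is_deriveM d1 d2)).
  by rewrite /GRing.scale/= powRB1//; field; rewrite gt_eqF.
have unbounded (e C p t1 : R) : 0 < e -> 0 < p ->
    ~ (forall t, t1 <= t -> p * t `^ e <= C).
  move=> e0 p0 h; have := powR_cvgy e0; move/cvgryPgt => /(_ (C / p)).
  move=> [M [_ hM]].
  have := hM (Num.max (M + 1) t1); rewrite lt_max ltrDl ltr01/= => /(_ isT).
  rewrite ltr_pdivrMr// mulrC ltNge => /negP; apply.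
  by apply: h; rewrite le_max lexx orbT.
have [[t1 [Tt1 at1]]|hneg] := pselect (exists t1, T < t1 /\ a t1 < 0).
  have hle (t : R) : t1 <= t -> a t <= a t1.
    move=> t1t; apply: (@nonincreasing_from _ a (fun t => - b t)) => // s t1s.
      by apply: da; exact: lt_le_trans t1s.
    by rewrite oppr_le0 ltW// b0//; exact: lt_le_trans t1s.
  (* As a <= a(t1) < 0 from t1 on, Q is nonincreasing there. *)
pose Q (t : R) := t `^ c * b t + (- a t1 / c) * t `^ c.
  have dQ (t : R) : t1 <= t -> is_derive t 1 Q (t `^ c / t * (a t - a t1)).
    move=> t1t; have Tt : T < t by exact: lt_le_trans t1t.
    have t0 : 0 < t by exact: lt_trans Tt.
    have d1 := is_derive1_powR c t0; have d2 := dP t Tt.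
    apply: (@is_derive_eq _ _ _ _ _ _ _ _
      (is_deriveD d2 (is_deriveZ (- a t1 / c) d1))).
    by rewrite /GRing.scale/= powRB1//; field; rewrite !gt_eqF.
  apply: (@unbounded c (Q t1) (- a t1 / c) t1) => //.
    by rewrite divr_gt0// oppr_gt0.
  move=> t t1t; have Tt : T < t by exact: lt_le_trans t1t.
  apply: (@le_trans _ _ (Q t)).
    by rewrite lerDr mulr_ge0 ?powR_ge0// ltW// b0.
  apply: (nonincreasing_from dQ) => // s t1s.
  have s0 : 0 < s by apply: lt_trans T0 _; exact: lt_le_trans t1s.
  by rewrite mulr_ge0_le0 ?divr_ge0 ?powR_ge0 ?(ltW s0)// subr_le0 hle.
have a0 (t : R) : T < t -> 0 <= a t.
  by move=> Tt; rewrite leNgt; apply/negP => h; apply: hneg; exists t.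
pose t1 := T + 1; have Tt1 : T < t1 by rewrite ltrDl.
have t10 : 0 < t1 by exact: lt_trans Tt1.
pose p := t1 `^ c * b t1; have p0 : 0 < p by rewrite mulr_gt0 ?powR_gt0 ?b0.
have hp (t : R) : t1 <= t -> p * t `^ (- c) <= b t.
  move=> t1t; have Tt : T < t by exact: lt_le_trans t1t.
  have t0 : 0 < t by exact: lt_trans Tt.
  rewrite powRN ler_pdivrMr ?powR_gt0// mulrC -lerN2.
  have dN (s : R) : t1 <= s ->
      is_derive s 1 (fun t => - (t `^ c * b t)) (- (s `^ c / s * a s)).
    by move=> t1s; apply: is_deriveN; apply: dP; exact: lt_le_trans t1s.
  apply: (nonincreasing_from dN) => // s t1s; rewrite oppr_le0.
  have Ts : T < s by exact: lt_le_trans t1s.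
  by rewrite mulr_ge0 ?a0// divr_ge0 ?powR_ge0// ltW// (lt_trans T0).
have c10 : 0 < 1 - c by rewrite subr_gt0.
(* As b >= p t^(-c) from t1 on, S is nonincreasing there. *)
pose S (t : R) := a t + p / (1 - c) * t `^ (1 - c).
have dS (t : R) : t1 <= t -> is_derive t 1 S (- b t + p * t `^ (- c)).
  move=> t1t; have Tt : T < t by exact: lt_le_trans t1t.
  have t0 : 0 < t by exact: lt_trans Tt.
  have d1 := is_derive1_powR (1 - c) t0; have d2 := da t Tt.
  apply: (@is_derive_eq _ _ _ _ _ _ _ _
    (is_deriveD d2 (is_deriveZ (p / (1 - c)) d1))).
  rewrite /GRing.scale/=; have -> : 1 - c - 1 = - c by ring.
  by field; rewrite gt_eqF.
apply: (@unbounded (1 - c) (S t1) (p / (1 - c)) t1) => //.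
  by rewrite divr_gt0.
move=> t t1t; apply: (@le_trans _ _ (S t)).
  by rewrite lerDr a0//; exact: lt_le_trans t1t.
by apply: (nonincreasing_from dS) => // s t1s; have := hp s t1s; lra.
Qed.

Lemma continuous_dhyp (R : realType) (k t : R) : 0 <= k ->
  {for t, continuous (dhyp k 0)}.
Proof.
move=> k0; apply: differentiable_continuous; apply/derivable1_diffP.
by apply: ex_derive; exact: is_derive_dhyp (admissible0 k).
Qed.

Lemma nonvanishing_sign (R : realType) (f : R -> R) (T s t : R) :
  continuous f -> (forall x, T < x -> f x != 0) ->
  T < s -> T < t -> 0 < f s -> 0 < f t.
Proof.
move=> cf nz Ts Tt fs; rewrite ltNge le_eqVlt; apply/negP => /predU1P[ft|ft].
  by have := nz t Tt; rewrite ft eqxx.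
have cw (x y : R) : {within `[x, y], continuous f} by exact: continuous_subspaceT.
have [st|ts] := leP s t.
  have [|c] := @IVT _ f s t 0 st (cw _ _).
    by rewrite ge_min le_max (ltW ft) (ltW fs) orbT.
  rewrite in_itv/= => /andP[sc _] fc; have := nz c (lt_le_trans Ts sc).
  by rewrite fc eqxx.
have [|c] := @IVT _ f t s 0 (ltW ts) (cw _ _).
  by rewrite ge_min le_max (ltW ft) (ltW fs) orbT.
rewrite in_itv/= => /andP[tc _] fc; have := nz c (lt_le_trans Tt tc).
by rewrite fc eqxx.
Qed.

Lemma dhyp_zeros_unbounded (R : realType) (k T : R) : 0 <= k < 1 / 2 -> 0 < T ->
  exists2 t, T < t & dhyp k 0 t = 0.
Proof.
move=> /andP[k0 k1] T0; apply: contrapT => no.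
have nz (t : R) : T < t -> dhyp k 0 t != 0.
  by move=> Tt; apply/eqP => h; apply: no; exists t.
have adm := admissible0 k.
have hc : 0 < k + 1 / 2 < 1 by apply/andP; split; lra.
have ch : continuous (dhyp k 0) by move=> t; exact: continuous_dhyp.
have ode (t : R) : 0 < t ->
    ddhyp k 0 t = (- hyp k 0 t - (k + 1 / 2) * dhyp k 0 t) / t.
  move=> t0; have := hyp_ode t k0 adm.
  rewrite mul0r subr0 mulr1 mulr0 mul0r subr0 => h.
  have tn0 : t != 0 by rewrite gt_eqF.
  by apply: (mulfI tn0); rewrite [RHS]mulrCA divff// mulr1; lra.
pose t1 := T + 1; have Tt1 : T < t1 by rewrite ltrDl.
have := nz t1 Tt1; rewrite neq_lt => /orP[h1|h1].
  apply: (@no_eventual_sign _ (hyp k 0) (fun t => - dhyp k 0 t) _ _ hc T0).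
  - by move=> t _; rewrite opprK; exact: is_derive_hyp.
  - move=> t Tt; have d1 := is_derive_dhyp t k0 adm.
    apply: (@is_derive_eq _ _ _ _ _ _ _ _ (is_deriveN d1)).
    have t0 : 0 < t by exact: lt_trans Tt.
    by rewrite ode//; field; rewrite gt_eqF.
  - move=> t Tt; apply: (@nonvanishing_sign _ (fun t => - dhyp k 0 t) T t1) => //.
    + by move=> x; apply: cvgN; exact: ch.
    + by move=> x /nz; rewrite oppr_eq0.
    + by rewrite oppr_gt0.
apply: (@no_eventual_sign _ (fun t => - hyp k 0 t) (dhyp k 0) _ _ hc T0).
- by move=> t _; apply: is_deriveN; exact: is_derive_hyp.
- move=> t Tt; have d1 := is_derive_dhyp t k0 adm.
  apply: (@is_derive_eq _ _ _ _ _ _ _ _ d1).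
  by rewrite ode//; exact: lt_trans Tt.
- by move=> t Tt; exact: (@nonvanishing_sign _ (dhyp k 0) T t1).
Qed.

(** A limit point of zeros would be a zero. It is not 0, where g' does not
    vanish; elsewhere g'' does not vanish at it because g does not, and Rolle's
    theorem isolates it. *)
Lemma dhyp_zeros_finite (R : realType) (k M : R) : 0 <= k <= 1 / 2 ->
  finite_set [set t | 0 < t <= M /\ dhyp k 0 t = 0].
Proof.
move=> hk; have k0 : 0 <= k by case/andP: hk.
have adm := admissible0 k; apply: contrapT => inf; set E := [set t | _] in inf.
have [|l El] := infinite_bounded_limit_point_nonempty inf.
  exists (`|M|); split; first exact: num_real.
  move=> x Mx t [/andP[t0 tM] _] /=; rewrite gtr0_norm// (le_trans tM)//.
  by rewrite (le_trans (ler_norm _))// ltW.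
have clash (U : set R) : nbhs l U -> (forall t, U t -> t != l -> ~ E t) -> False.
  by move=> /El[t [tl Et Ut]] h; exact: (h t).
have ch : {for l, continuous (dhyp k 0)} by exact: continuous_dhyp.
have [hl|hl] := eqVneq (dhyp k 0 l) 0; last first.
  apply: (clash [set t | dhyp k 0 t != 0]); last first.
    by move=> t /eqP h _ [_ /h].
  exact: (cvgr_neq0 _ ch hl).
have [l0|l0] := leP l 0.
  move: l0; rewrite le_eqVlt => /predU1P[l0|l0].
    move: hl; rewrite l0 /dhyp psum0 /pseries_diffs mul1r => h.
    have := coefS 0 0 k0; rewrite coef0 h !(mulr0, mul0r) subr0 mulr1.
    by move/eqP; rewrite eq_sym oppr_eq0 oner_eq0.
  apply: (clash [set t | t < 0]).
    exact: lt_nbhsl.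
  by move=> t /= tl _ [/andP[]]; rewrite ltNge (ltW tl).
have gl := hyp_no_double_zero hk l0 hl.
have dl : ddhyp k 0 l != 0.
  have := hyp_ode l k0 adm; rewrite hl mulr0 addr0 mul0r subr0 mulr1 => ode.
  by apply: contra_neq gl => d0; move: ode; rewrite d0 mulr0 add0r.
have cdd : {for l, continuous (ddhyp k 0)}.
  apply: differentiable_continuous; apply/derivable1_diffP; apply: ex_derive.
  exact: is_derive_psum
    (exp_bounded_diffs (exp_bounded_diffs (exp_bounded_coef k0 adm))).
have /nbhs_ballP[e /= e0 he] : \forall t \near l, ddhyp k 0 t != 0.
  exact: (cvgr_neq0 _ cdd dl).
apply: (clash (ball l e)); first exact: nbhsx_ballx.
move=> t; rewrite -ball_normE/= => tl tnl [_ ht].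
have der (x : R) : is_derive x 1 (dhyp k 0) (ddhyp k 0 x).
  exact: is_derive_dhyp.
have cw (x y : R) : {within `[x, y], continuous (dhyp k 0)}.
  by apply: continuous_subspaceT => z; exact: continuous_dhyp.
have rolle (x y : R) : x < y -> dhyp k 0 x = 0 -> dhyp k 0 y = 0 ->
    exists2 c, x < c < y & ddhyp k 0 c = 0.
  move=> xy hx hy.
  have [c cxy] := MVT xy (fun z _ => der z) (cw x y).
  rewrite hx hy subrr => /esym/eqP; rewrite mulf_eq0 subr_eq0 (gt_eqF xy) orbF.
  by move=> /eqP h; exists c => //; move: cxy; rewrite in_itv.
move: tnl; rewrite neq_lt => /orP[lt|lt].
  have [c /andP[tc cl] dc] := rolle _ _ lt ht hl.
  suff : ddhyp k 0 c != 0 by rewrite dc eqxx.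
  apply: he; rewrite -ball_normE/= gtr0_norm ?subr_gt0//.
  by move: tl; rewrite gtr0_norm ?subr_gt0//; lra.
have [c /andP[tc cl] dc] := rolle _ _ lt hl ht.
suff : ddhyp k 0 c != 0 by rewrite dc eqxx.
apply: he; rewrite -ball_normE/= ltr0_norm ?subr_lt0//.
by move: tl; rewrite ltr0_norm ?subr_lt0//; lra.
Qed.

Lemma seq_has_min (R : realType) (s : seq R) : s != [::] ->
  exists2 m, m \in s & forall x, x \in s -> m <= x.
Proof.
elim: s => // x [|y s] IH _.
  by exists x; rewrite ?mem_head// => z; rewrite inE => /eqP ->.
have [//|m ms mle] := IH; have [xm|mx] := leP x m.
  exists x; rewrite ?mem_head// => z; rewrite inE => /predU1P[->//|/mle].
  exact: le_trans.
exists m; first by rewrite inE ms orbT.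
by move=> z; rewrite inE => /predU1P[->|/mle//]; exact: ltW.
Qed.

(** The next zero is the least element of a finite nonempty set of zeros. *)
Lemma enumerate_zeros (R : realType) (P : set R) (n : nat) :
  (forall M, finite_set [set z | 0 < z <= M /\ P z]) ->
  (forall M, 0 < M -> exists2 z, M < z & P z) ->
  exists y, [/\ 0 <= y, (0 < n)%N -> 0 < y /\ P y
    & ([set z | 0 < z <= y /\ P z] #= `I_n)%card].
Proof.
move=> fin unb; elim: n => [|n [y [y0 _ cy]]].
  exists 0; split => //; rewrite II0 card_eq0; apply/eqP/seteqP; split => // z.
  by move=> [/andP[z0]]; rewrite leNgt z0.
have y1 : 0 < y + 1 by lra.
have [z1 yz1 Pz1] := unb _ y1.
have /finite_seqP[s sE] : finite_set [set z | y < z <= z1 /\ P z].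
  apply: sub_finite_set (fin z1) => z [/andP[yz zz1] Pz].
  by rewrite /= zz1 (le_lt_trans y0 yz).
have memE z : (z \in s) <-> (y < z <= z1 /\ P z).
  have : [set` s] z <-> [set z | y < z <= z1 /\ P z] z by rewrite sE.
  by [].
have s0 : s != [::].
  have : z1 \in s by apply/memE; rewrite lexx andbT; split => //; lra.
  by case: s {sE memE}.
have [m /memE[/andP[ym mz1] Pm] mle] := seq_has_min s0.
have m0 : 0 < m by exact: le_lt_trans ym.
exists m; split; [exact: ltW | by [] |].
apply/eq_cardSP; exists m; first by rewrite /= m0 lexx.
rewrite [X in (X #= _)%card](_ : _ = [set z | 0 < z <= y /\ P z])//.
apply/seteqP; split => z /=.
  move=> [[/andP[z0 zm] Pz] znm]; rewrite z0/=; split => //.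
  rewrite leNgt; apply/negP => yz; apply: znm; apply/eqP; rewrite eq_le zm/=.
  by apply: mle; apply/memE; rewrite yz (le_trans zm).
move=> [/andP[z0 zy] Pz]; split.
  by rewrite z0 (le_trans zy (ltW ym)).
by move=> zm; move: ym; rewrite -zm ltNge zy.
Qed.

(** * The Bessel functions of the theorem *)

Lemma energy_lim (R : realType) (k : R) : 0 <= k <= 1 / 2 ->
  energy k 0 t @[t --> +oo] --> Gamma (k + 1 / 2) ^+ 2 / pi.
Proof.
move=> hk; have := energy_bracket hk (endpoint_energy_cvg hk).
set L := _ / pi => hL.
have sc : Num.sqrt (t^-1 : R) @[t --> +oo] --> (0 : R).
  rewrite -[X in _ --> X](@sqrtr0 R); apply: continuous_cvg.
    exact: sqrt_continuous.
  apply/gtr0_cvgV0; last exact: cvg_id.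
  by near=> t; near: t; exact: nbhs_pinfty_gt.
have ec (e : R) : L * expR (e * Num.sqrt (t^-1 : R)) @[t --> +oo] --> L.
  suff : L * expR (e * Num.sqrt (t^-1 : R)) @[t --> +oo] --> L * expR (e * 0).
    by rewrite mulr0 expR0 mulr1.
  apply: cvgM; first exact: cvg_cst.
  apply: continuous_cvg; first exact: continuous_expR.
  by apply: cvgM => //; exact: cvg_cst.
apply: (@squeeze_cvgr _ _ _ _ _ _ _ _ _ (ec (-1)) (ec 1)).
near=> t; have t1 : 1 <= t by near: t; exact: nbhs_pinfty_ge.
have /andP[h1 h2] := hL t t1; rewrite mulN1r mul1r; apply/andP; split.
  by rewrite expRN ler_pdivrMr ?expR_gt0.
by rewrite -ler_pdivrMr ?expR_gt0// -expRN.
Unshelve. all: by end_near. Qed.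

Lemma psumZ (R : realType) (M r t C : R) (u : nat -> R) : exp_bounded M r u ->
  limn (series (fun m => C * (u m * t ^+ m))) = C * psum u t.
Proof.
move=> uM; apply/cvg_lim => //.
rewrite [X in X @ \oo](_ : _ = (fun n => C * pseries u t n)).
  by apply: cvgM; [exact: cvg_cst | exact: cvg_pseries uM].
by apply/funext => n; rewrite /pseries /series /= mulr_sumr.
Qed.

Lemma bessel_power (R : realType) (y mu : R) (m : nat) : 0 < y ->
  (y / 2) `^ (2 * m%:R + mu) = (y / 2) `^ mu * ((y / 2) ^+ 2) ^+ m.
Proof.
move=> y0; have y2 : 0 < y / 2 by rewrite divr_gt0.
rewrite powRD ?(gt_eqF y2) ?implybT// mulrC; congr (_ * _).
by rewrite -natrM powR_mulrn ?(ltW y2)// exprM.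
Qed.

Lemma besselJ_hyp (R : realType) (k y : R) : 0 <= k -> 0 < y ->
  besselJ (k - 1 / 2) y
    = (y / 2) `^ (k - 1 / 2) / Gamma (k + 1 / 2) * hyp k 0 ((y / 2) ^+ 2).
Proof.
move=> k0 y0; have hc : 0 < k + 1 / 2 by lra.
rewrite -(psumZ _ _ (exp_bounded_coef k0 (admissible0 k))) /besselJ.
congr (limn (series _)); apply/funext => m.
rewrite bessel_power// /coef damping0r.
have -> : m%:R + (k - 1 / 2) + 1 = k + 1 / 2 + m%:R by field.
rewrite rising_Gamma//; have gc := Gamma_gt0 hc; have rc := rising_gt0 m hc.
have hf : (m`!%:R : R) != 0 by rewrite pnatr_eq0 -lt0n fact_gt0.
move: gc rc hf; move: (Gamma _) (rising _ _) (m`!%:R : R) => u v w u0 v0 w0.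
by field; rewrite w0 !gt_eqF.
Qed.

Lemma besselJ_dhyp (R : realType) (k y : R) : 0 <= k -> 0 < y ->
  besselJ (k + 1 / 2) y
    = - ((y / 2) `^ (k + 1 / 2) / Gamma (k + 1 / 2)) * dhyp k 0 ((y / 2) ^+ 2).
Proof.
move=> k0 y0; have hc : 0 < k + 1 / 2 by lra.
rewrite -(psumZ _ _ (exp_bounded_diffs (exp_bounded_coef k0 (admissible0 k)))).
rewrite /besselJ; congr (limn (series _)); apply/funext => m.
rewrite bessel_power// /pseries_diffs /coef damping0r.
have -> : m%:R + (k + 1 / 2) + 1 = k + 1 / 2 + m.+1%:R by rewrite -natr1; ring.
rewrite rising_Gamma// factS natrM (exprS _ m).
have gc := Gamma_gt0 hc; have rc := rising_gt0 m.+1 hc.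
have hf : (m`!%:R : R) != 0 by rewrite pnatr_eq0 -lt0n fact_gt0.
have hm : (m.+1%:R : R) != 0 by rewrite pnatr_eq0.
move: gc rc hf hm; move: (Gamma _) (rising _ _) (m`!%:R : R) (m.+1%:R : R).
by move=> u v w z u0 v0 w0 z0; field; rewrite w0 z0 !gt_eqF.
Qed.

Lemma besselJ_zeroE (R : realType) (k y : R) : 0 <= k -> 0 < y ->
  (besselJ (k + 1 / 2) y = 0) <-> (dhyp k 0 ((y / 2) ^+ 2) = 0).
Proof.
move=> k0 y0; have hc : 0 < k + 1 / 2 by lra.
have p0 : 0 < (y / 2) `^ (k + 1 / 2) / Gamma (k + 1 / 2).
  by rewrite divr_gt0 ?Gamma_gt0// powR_gt0// divr_gt0.
rewrite besselJ_dhyp//; split => [/eqP|->]; last by rewrite mulr0.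
by rewrite mulf_eq0 oppr_eq0 (gt_eqF p0) => /eqP.
Qed.

Lemma half_sqrK (R : realType) (t : R) : 0 <= t ->
  (2 * Num.sqrt t / 2) ^+ 2 = t.
Proof. by move=> t0; rewrite mulrAC divff// mul1r sqr_sqrtr. Qed.

Lemma besselJ_zeros_finite (R : realType) (k M : R) : 0 <= k <= 1 / 2 ->
  finite_set [set z | 0 < z <= M /\ besselJ (k + 1 / 2) z = 0].
Proof.
move=> hk; have k0 : 0 <= k by case/andP: hk.
apply: sub_finite_set (finite_image (fun t => 2 * Num.sqrt t)
  (dhyp_zeros_finite ((M / 2) ^+ 2) hk)) => z [/andP[z0 zM] /besselJ_zeroE hz].
exists ((z / 2) ^+ 2).
  split; last exact: hz.
  have z2 : 0 < z / 2 by rewrite divr_gt0.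
  rewrite exprn_gt0//= ler_sqr ?nnegrE; lra.
by rewrite sqrtr_sqr ger0_norm ?divr_ge0 ?(ltW z0)// mulrC divfK.
Qed.

Lemma besselJ_zeros_unbounded (R : realType) (k M : R) :
  0 <= k < 1 / 2 -> 0 < M -> exists2 z, M < z & besselJ (k + 1 / 2) z = 0.
Proof.
move=> hk M0; have k0 : 0 <= k by case/andP: hk.
have M2 : 0 < (M / 2) ^+ 2 by rewrite exprn_gt0// divr_gt0.
have [t Mt ht] := dhyp_zeros_unbounded hk M2.
have t0 : 0 < t by exact: lt_trans Mt.
exists (2 * Num.sqrt t).
  rewrite -ltr_pdivrMl// mulrC -[ltLHS]ger0_norm ?divr_ge0 ?(ltW M0)//.
  by rewrite -sqrtr_sqr ltr_sqrt.
apply/besselJ_zeroE => //; first by rewrite mulr_gt0// sqrtr_gt0.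
by rewrite half_sqrK// ltW.
Qed.

Lemma bessel_zeroP (R : realType) (k : R) (n : nat) :
  0 <= k < 1 / 2 -> (0 < n)%N ->
  [/\ 0 < bessel_zero (k + 1 / 2) n,
      besselJ (k + 1 / 2) (bessel_zero (k + 1 / 2) n) = 0
    & ([set z | 0 < z <= bessel_zero (k + 1 / 2) n
         /\ besselJ (k + 1 / 2) z = 0] #= `I_n)%card].
Proof.
move=> hk n0; have hk' : 0 <= k <= 1 / 2 by case/andP: hk => -> /ltW ->.
rewrite /bessel_zero; set P := [set y | _].
suff : P (xget 0 P) by [].
apply: xgetPex.
have [y [_ /(_ n0)[y0 hy] cy]] := @enumerate_zeros R
  [set z | besselJ (k + 1 / 2) z = 0] n
  (fun M => besselJ_zeros_finite M hk')
  (fun M => besselJ_zeros_unbounded hk).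
by exists y; split.
Qed.

Lemma bessel_zero_cvgy (R : realType) (k : R) : 0 <= k < 1 / 2 ->
  bessel_zero (k + 1 / 2) n @[n --> \oo] --> +oo.
Proof.
move=> hk; have hk' : 0 <= k <= 1 / 2 by case/andP: hk => -> /ltW ->.
apply/cvgryPgt => M.
have [p cp] := besselJ_zeros_finite M hk'.
near=> n; have n0 : (0 < n)%N by near: n; exact: nbhs_infty_gt.
have pn : (p < n)%N by near: n; exact: nbhs_infty_gt.
have [_ _ cn] := bessel_zeroP hk n0.
rewrite ltNge; apply/negP => yM.
suff : (`I_n #<= `I_p)%card by rewrite card_le_II leqNgt pn.
rewrite -(card_le_eql cn) -(card_le_eqr cp).
apply: subset_card_le => z [/andP[z0 zy] hz]; split => //.
by rewrite z0 (le_trans zy).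
Unshelve. all: by end_near. Qed.

(** * The eigenfunctions in terms of the Bessel series *)

(** The parameter k: the orders of the two Bessel functions are k - 1/2 and k +
    1/2. *)
Definition order_shift {R : realType} (alpha : R) : R := 1 / 2 - nu alpha.

Lemma order_shift_bounds (R : realType) (alpha : R) : 0 <= alpha -> alpha < 1 ->
  0 <= order_shift alpha < 1 / 2.
Proof.
move=> a0 a1; have h : 0 < 2 - alpha by lra.
have n0 : 0 < nu alpha by rewrite divr_gt0//; lra.
have n1 : nu alpha <= 1 / 2 by rewrite ler_pdivrMr//; lra.
by rewrite /order_shift; apply/andP; split; lra.
Qed.

Lemma order_shiftE (R : realType) (alpha : R) : alpha < 1 ->
  order_shift alpha + 1 / 2 = (2 - alpha)^-1.
Proof.
move=> a1; have h : 2 - alpha != 0 by rewrite gt_eqF; lra.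
by rewrite /order_shift /nu; field.
Qed.

Lemma order_shift_eq0 (R : realType) (alpha : R) : alpha < 1 ->
  order_shift alpha = 0 <-> alpha = 0.
Proof.
move=> a1; have h : 2 - alpha != 0 by rewrite gt_eqF; lra.
have -> : order_shift alpha = alpha / (2 * (2 - alpha)).
  by rewrite /order_shift /nu; field.
split=> [/eqP|->]; last by rewrite mul0r.
by rewrite mulf_eq0 invr_eq0 mulf_eq0 (negbTE h) pnatr_eq0/= orbF => /eqP.
Qed.

Lemma jE (R : realType) (alpha : R) (n : nat) :
  j alpha n = bessel_zero (order_shift alpha + 1 / 2) n.
Proof.
have e : - nu alpha + 1 = order_shift alpha + 1 / 2.
  by rewrite /order_shift; field.
by rewrite /j e.
Qed.

Definition jpar {R : realType} (alpha : R) (n : nat) : R := (j alpha n / 2) ^+ 2.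

(** The value of phi at 0. *)
Definition phi0 {R : realType} (alpha : R) (n : nat) : R :=
  (j alpha n / 2) `^ (- nu alpha) / Gamma (order_shift alpha + 1 / 2).

Lemma j_gt0 (R : realType) (alpha : R) (n : nat) :
  0 <= alpha -> alpha < 1 -> (0 < n)%N -> 0 < j alpha n.
Proof.
move=> a0 a1 n0; rewrite jE.
by have [] := bessel_zeroP (order_shift_bounds a0 a1) n0.
Qed.

Lemma dhyp_jpar (R : realType) (alpha : R) (n : nat) :
  0 <= alpha -> alpha < 1 -> (0 < n)%N ->
  dhyp (order_shift alpha) 0 (jpar alpha n) = 0.
Proof.
move=> a0 a1 n0; have hk := order_shift_bounds a0 a1.
have [y0 hy _] := bessel_zeroP hk n0; rewrite /jpar jE.
have /andP[k0 _] := hk.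
exact: (proj1 (besselJ_zeroE k0 y0) hy).
Qed.

Lemma phi0_gt0 (R : realType) (alpha : R) (n : nat) :
  0 <= alpha -> alpha < 1 -> (0 < n)%N -> 0 < phi0 alpha n.
Proof.
move=> a0 a1 n0; rewrite divr_gt0//.
  by rewrite powR_gt0// divr_gt0// j_gt0.
by rewrite Gamma_gt0// order_shiftE// invr_gt0; lra.
Qed.

Lemma phiE (R : realType) (alpha x : R) (n : nat) :
  0 <= alpha -> alpha < 1 -> (0 < n)%N -> 0 < x ->
  phi alpha n x
    = phi0 alpha n * hyp (order_shift alpha) 0 (jpar alpha n * x `^ (2 - alpha)).
Proof.
move=> a0 a1 n0 x0; have /andP[k0 k1] := order_shift_bounds a0 a1.
have y0 := j_gt0 a0 a1 n0; rewrite /phi.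
have xp : 0 < x `^ ((2 - alpha) / 2) by rewrite powR_gt0.
have -> : - nu alpha = order_shift alpha - 1 / 2 by rewrite /order_shift; ring.
rewrite besselJ_hyp//; last by rewrite mulr_gt0.
have -> : j alpha n * x `^ ((2 - alpha) / 2) / 2
  = j alpha n / 2 * x `^ ((2 - alpha) / 2) by rewrite mulrAC.
have sq : x `^ ((2 - alpha) / 2) ^+ 2 = x `^ (2 - alpha).
  by rewrite -powR_mulrn ?powR_ge0// -powRrM divfK.
rewrite exprMn sq.
have -> : order_shift alpha - 1 / 2 = - nu alpha by rewrite /order_shift; ring.
rewrite powRM ?divr_ge0 ?(ltW y0) ?(ltW xp)// -powRrM.
have -> : (2 - alpha) / 2 * - nu alpha = - ((1 - alpha) / 2).
  by rewrite /nu; field; rewrite gt_eqF; lra.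
rewrite (powRN x) /phi0 -/(jpar alpha n).
have q0 : x `^ ((1 - alpha) / 2) != 0 by rewrite gt_eqF// powR_gt0.
have c0 : 0 < order_shift alpha + 1 / 2 by lra.
have := gt_eqF (Gamma_gt0 c0); move: (Gamma _) => u u0.
by field; rewrite q0 u0.
Qed.

(** Up to the factor 2 t^(1-nu) / Gamma(1-nu)^2, this is Lommel's primitive of
    y J_{-nu}(y)^2 at t = (y/2)^2. *)
Definition lommel {R : realType} (alpha t : R) : R :=
  hyp (order_shift alpha) 0 t ^+ 2 + t * dhyp (order_shift alpha) 0 t ^+ 2
  - nu alpha * (hyp (order_shift alpha) 0 t * dhyp (order_shift alpha) 0 t).

Lemma is_derive_lommel (R : realType) (alpha x T : R) :
  0 <= alpha -> alpha < 1 -> 0 < x ->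
  is_derive x 1
    (fun x => (2 - alpha)^-1 * (x * lommel alpha (T * x `^ (2 - alpha))))
    (hyp (order_shift alpha) 0 (T * x `^ (2 - alpha)) ^+ 2).
Proof.
move=> a0 a1 x0; have /andP[k0 k1] := order_shift_bounds a0 a1.
have adm := admissible0 (order_shift alpha).
set t := T * x `^ (2 - alpha).
have hg := is_derive_hyp t k0 adm; have hh := is_derive_dhyp t k0 adm.
have ode := hyp_ode t k0 adm; move: ode.
rewrite mul0r subr0 mulr1 mulr0 mul0r subr0 => ode.
pose dL := 2 * (hyp (order_shift alpha) 0 t * dhyp (order_shift alpha) 0 t)
  + dhyp (order_shift alpha) 0 t ^+ 2
  + 2 * t * (dhyp (order_shift alpha) 0 t * ddhyp (order_shift alpha) 0 t)
  - nu alpha * (dhyp (order_shift alpha) 0 t ^+ 2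
      + hyp (order_shift alpha) 0 t * ddhyp (order_shift alpha) 0 t).
have hl : is_derive t 1 (lommel alpha) dL.
  by apply: is_derive_eq; rewrite /GRing.scale/= /dL; ring.
have hp : is_derive x 1 (fun x => T * x `^ (2 - alpha)) ((2 - alpha) * t / x).
  have d1 := is_derive1_powR (2 - alpha) x0.
  apply: (@is_derive_eq _ _ _ _ _ _ _ _ (is_deriveZ T d1)).
  by rewrite /GRing.scale/= powRB1// /t; ring.
have hc := @is_derive1_comp _ (lommel alpha) (fun x => T * x `^ (2 - alpha))
  x _ _ hl hp.
have hm := is_deriveM (is_derive_id x 1) hc.
apply: (@is_derive_eq _ _ _ _ _ _ _ _ (is_deriveZ (2 - alpha)^-1 hm)).
rewrite /GRing.scale/= -/t /lommel /dL.
move: ode; rewrite order_shiftE//.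
move: (hyp _ 0 t) (dhyp _ 0 t) (ddhyp _ 0 t) => g h h2 ode.
have a2 : 2 - alpha != 0 by rewrite gt_eqF; lra.
apply: (@etrans _ _ (g ^+ 2 + (t * h2 + (2 - alpha)^-1 * h + g)
  * (2 * t * h - nu alpha * g))); last by rewrite ode mul0r addr0.
rewrite /nu; field.
by rewrite a2 gt_eqF.
Qed.

(** * Normalization and boundary values *)

Section composed_with_power.
Context (R : realType) (G : R -> R) (T r : R).
Context (cG : continuous G) (r0 : 0 < r).

Let cGT (x : R) : {for x, continuous (fun x => G (T * x))}.
Proof.
apply: continuous_comp; last exact: cG.
by apply: cvgM; [exact: cvg_cst | exact: cvg_id].
Qed.

Lemma cvg_powR_at0 : G (T * x `^ r) @[x --> 0^'+] --> G 0.
Proof.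
have := @cGT 0; rewrite /prop_for /continuous_at mulr0 => c.
exact: (cvg_comp _ _ (powR_cvg0 r0) c).
Qed.

Lemma continuous_powR_pos (x : R) : 0 < x ->
  {for x, continuous (fun x => G (T * x `^ r))}.
Proof.
move=> x0; apply: (@continuous_comp _ _ _ (fun x => x `^ r)
  (fun x => G (T * x))); [exact: continuous_powR | exact: cGT].
Qed.

Lemma cvg_powR_at1 : G (T * x `^ r) @[x --> 1^'-] --> G T.
Proof.
have -> : G T = G (T * 1 `^ r) by rewrite powR1 mulr1.
by apply: cvg_at_left_filter; exact: (@continuous_powR_pos 1 ltr01).
Qed.

Lemma within_powR : {within `[0, 1], continuous (fun x => G (T * x `^ r))}.
Proof.
apply/(continuous_within_itvP _ ltr01); split.
- by move=> x; rewrite in_itv/= => /andP[x0 _]; exact: continuous_powR_pos.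
- by rewrite powR0 ?gt_eqF// mulr0; exact: cvg_powR_at0.
- by rewrite powR1 mulr1; exact: cvg_powR_at1.
Qed.

End composed_with_power.

Lemma continuous_hyp (R : realType) (k : R) : 0 <= k -> continuous (hyp k 0).
Proof.
move=> k0 t; apply: differentiable_continuous; apply/derivable1_diffP.
by apply: ex_derive; exact: is_derive_hyp (admissible0 k).
Qed.

Lemma integral_hyp_sqr (R : realType) (alpha T C : R) :
  0 <= alpha -> alpha < 1 -> dhyp (order_shift alpha) 0 T = 0 ->
  (\int[lebesgue_measure]_(x in `]0%R, 1%R[)
     ((C * hyp (order_shift alpha) 0 (T * x `^ (2 - alpha))) ^+ 2)%:E
   = (C ^+ 2 * ((2 - alpha)^-1 * hyp (order_shift alpha) 0 T ^+ 2))%:E)%E.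
Proof.
move=> a0 a1 hT; have /andP[k0 k1] := order_shift_bounds a0 a1.
have r0 : 0 < 2 - alpha by lra.
have cg := continuous_hyp k0.
pose f (x : R) := (C * hyp (order_shift alpha) 0 (T * x `^ (2 - alpha))) ^+ 2.
pose L (x : R) := lommel alpha (T * x `^ (2 - alpha)).
pose F (x : R) := C ^+ 2 * ((2 - alpha)^-1 * (x * L x)).
have cL : continuous (lommel alpha).
  have cd : continuous (dhyp (order_shift alpha) 0).
    by move=> t; exact: continuous_dhyp.
  move=> t; apply: cvgB; last first.
    by apply: cvgM; [exact: cvg_cst | apply: cvgM; [exact: cg | exact: cd]].
  apply: cvgD; first by apply: cvgM; exact: cg.
  by apply: cvgM; [exact: cvg_id | apply: cvgM; exact: cd].
have cf : {within `[0, 1], continuous f}.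
  apply: (@within_powR _ (fun t => (C * hyp (order_shift alpha) 0 t) ^+ 2)) => //.
  by move=> t; apply: cvgM; (apply: cvgM; [exact: cvg_cst | exact: cg]).
rewrite -[LHS](@integral_itv_bndoo R 0 1 (EFin \o f) true false); last first.
  apply/measurable_EFinP; apply: subspace_continuous_measurable_fun.
    exact: measurable_itv.
  by apply: continuous_subspaceW cf; exact: subset_itv_oo_cc.
rewrite (@continuous_FTC2 _ f F 0 1 ltr01 cf).
- rewrite -EFinB /F /L mul0r !mulr0 subr0 powR1 mulr1 mul1r /lommel hT.
  by rewrite expr0n/= !mulr0 subr0 addr0.
- split.
  + move=> x; rewrite in_itv/= => /andP[x0 _].
    exact: (@ex_derive _ _ _ _ _ _ _
      (is_deriveZ (C ^+ 2) (is_derive_lommel T a0 a1 x0))).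
  + apply: cvgM; first exact: cvg_cst.
    apply: cvgM; first exact: cvg_cst.
    apply: cvgM; first by apply: cvg_at_right_filter; exact: cvg_id.
    by rewrite /L powR0 ?gt_eqF// mulr0; exact: cvg_powR_at0.
  + apply: cvgM; first exact: cvg_cst.
    apply: cvgM; first exact: cvg_cst.
    apply: cvgM; first by apply: cvg_at_left_filter; exact: cvg_id.
    by rewrite /L powR1 mulr1; exact: cvg_powR_at1.
- move=> x; rewrite in_itv/= => /andP[x0 _]; rewrite derive1E.
  have d := is_derive_lommel T a0 a1 x0.
  rewrite (@derive_val _ _ _ _ _ _ _ (is_deriveZ (C ^+ 2) d)).
  by rewrite /f /GRing.scale/= exprMn.
Qed.

Lemma L2norm01_eq1 (R : realType) (f : R -> R) (I : R) :
  (\int[lebesgue_measure]_(x in `]0%R, 1%R[) (f x ^+ 2)%:E = I%:E)%E ->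
  L2norm01 f = 1%E <-> I = 1.
Proof.
move=> fI; have n2 : 2 != 0 :> R by rewrite pnatr_eq0.
have sq : (L2norm01 f `^ 2 = I%:E)%E.
  rewrite /L2norm01 poweR_Lnorm// -fI [RHS]integral_mkcond.
  apply: eq_integral => x _; rewrite /= patchE [in RHS]patchE.
  case: ifPn => _ /=.
    by rewrite powR_mulrn// real_normK ?num_real.
  by rewrite normr0 powR0.
split=> [n1|I1].
  by move: sq; rewrite n1 poweR1r => -[].
have : (L2norm01 f = (L2norm01 f `^ 2) `^ 2^-1)%E.
  by rewrite -poweRrM mulfV// poweRe1// Lnorm_ge0.
by rewrite sq I1 poweR1r.
Qed.

Section normalized.
Context (R : realType) (alpha : R) (n : nat).
Context (a0 : 0 <= alpha) (a1 : alpha < 1) (n0 : (0 < n)%N).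

Let k := order_shift alpha.
Let T := jpar alpha n.
Let A := phi0 alpha n.

Lemma hyp_jpar_neq0 : hyp k 0 T != 0.
Proof.
have /andP[k0 k1] := order_shift_bounds a0 a1.
apply: hyp_no_double_zero; first by rewrite k0 ltW.
  by rewrite /T /jpar exprn_gt0// divr_gt0// j_gt0.
exact: dhyp_jpar.
Qed.

(** The square of the norm of phi is phi(0)^2 g(T)^2 / (2-alpha), because the
    derivative of g vanishes at T. *)
Lemma L2norm01_phi (K : R) :
  L2norm01 (fun x => K * phi alpha n x) = 1%E
    <-> (K * A * `|hyp k 0 T|) ^+ 2 = 2 - alpha.
Proof.
have al : 2 - alpha != 0.
  by rewrite gt_eqF// subr_gt0 (lt_trans a1)// ltr1n.
have h : (\int[lebesgue_measure]_(x in `]0%R, 1%R[)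
    ((K * phi alpha n x) ^+ 2)%:E
   = ((K * A) ^+ 2 * ((2 - alpha)^-1 * hyp k 0 T ^+ 2))%:E)%E.
  rewrite -(integral_hyp_sqr (K * A) a0 a1 (dhyp_jpar a0 a1 n0)).
  apply: eq_integral => x; rewrite inE/= in_itv/= => /andP[x0 _].
  by rewrite phiE// mulrA.
apply: (iff_trans (L2norm01_eq1 h)).
have -> : (K * A * `|hyp k 0 T|) ^+ 2 = (K * A) ^+ 2 * hyp k 0 T ^+ 2.
  by rewrite [LHS]exprMn real_normK ?num_real.
rewrite mulrCA.
split => [e|->]; last by rewrite mulVf.
by apply: (mulfI (invr_neq0 al)); rewrite e mulVf.
Qed.

Lemma KnormE : Knorm alpha n * A = Num.sqrt (2 - alpha) / `|hyp k 0 T|.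
Proof.
have A0 : 0 < A by exact: phi0_gt0.
have g0 : 0 < `|hyp k 0 T| by rewrite normr_gt0 hyp_jpar_neq0.
have s0 : 0 < 2 - alpha by rewrite subr_gt0 (lt_trans a1)// ltr1n.
have : [set K | 0 < K /\ L2norm01 (fun x => K * phi alpha n x) = 1%E]
    (Knorm alpha n).
  apply: xgetPex; exists (Num.sqrt (2 - alpha) / `|hyp k 0 T| / A); split.
    by apply: divr_gt0 => //; apply: divr_gt0 => //; rewrite sqrtr_gt0.
  by apply/L2norm01_phi; rewrite !divfK ?gt_eqF// sqr_sqrtr// ltW.
move=> [K0 /L2norm01_phi hK].
have h : 0 <= Knorm alpha n * A * `|hyp k 0 T|.
  by apply: ltW; apply: mulr_gt0 => //; exact: mulr_gt0.
rewrite -[in RHS]hK sqrtr_sqr (ger0_norm h) mulfK// gt_eqF//.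
Qed.

Lemma Phi_cvg0 :
  Phi alpha n x @[x --> 0^'+] --> Num.sqrt (2 - alpha) / `|hyp k 0 T|.
Proof.
have /andP[k0 k1] := order_shift_bounds a0 a1.
have r0 : 0 < 2 - alpha by rewrite subr_gt0 (lt_trans a1)// ltr1n.
have c : Num.sqrt (2 - alpha) / `|hyp k 0 T| * hyp k 0 (T * x `^ (2 - alpha))
    @[x --> 0^'+] --> Num.sqrt (2 - alpha) / `|hyp k 0 T| * hyp k 0 0.
  apply: cvgM; first exact: cvg_cst.
  exact: (@cvg_powR_at0 R (hyp k 0) T _ (continuous_hyp k0) r0).
rewrite hyp0 mulr1 in c; apply: cvg_trans c; apply: near_eq_cvg.
near=> x; have x0 : 0 < x by near: x; exact: nbhs_right_gt.
by rewrite /Phi phiE// mulrA -KnormE.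
Unshelve. all: by end_near. Qed.

Lemma Phi_cvg1 : Phi alpha n x @[x --> 1^'-]
    --> Num.sqrt (2 - alpha) / `|hyp k 0 T| * hyp k 0 T.
Proof.
have /andP[k0 k1] := order_shift_bounds a0 a1.
have r0 : 0 < 2 - alpha by rewrite subr_gt0 (lt_trans a1)// ltr1n.
have c : Num.sqrt (2 - alpha) / `|hyp k 0 T| * hyp k 0 (T * x `^ (2 - alpha))
    @[x --> 1^'-] --> Num.sqrt (2 - alpha) / `|hyp k 0 T| * hyp k 0 T.
  apply: cvgM; first exact: cvg_cst.
  exact: (@cvg_powR_at1 R (hyp k 0) T _ (continuous_hyp k0)).
apply: cvg_trans c; apply: near_eq_cvg.
near=> x; have x0 : 0 < x.
  by near: x; apply: nbhs_left_gt; exact: ltr01.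
by rewrite /Phi phiE// mulrA -KnormE.
Unshelve. all: by end_near. Qed.

Lemma Phi_at0E : Phi_at0 alpha n = Num.sqrt (2 - alpha) / `|hyp k 0 T|.
Proof. by apply/cvg_lim => //; exact: Phi_cvg0. Qed.

Lemma Phi_at1_norm : `|Phi_at1 alpha n| = Num.sqrt (2 - alpha).
Proof.
have -> : Phi_at1 alpha n = Num.sqrt (2 - alpha) / `|hyp k 0 T| * hyp k 0 T.
  by apply/cvg_lim => //; exact: Phi_cvg1.
have gn : `|hyp k 0 T| != 0 by rewrite normr_eq0 hyp_jpar_neq0.
by rewrite !normrM normfV normr_id divfK// ger0_norm// sqrtr_ge0.
Qed.

Lemma energy_jpar : energy k 0 T = (T `^ (k / 2) * `|hyp k 0 T|) ^+ 2.
Proof.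
rewrite /energy [dhyp _ _ T](dhyp_jpar a0 a1 n0) expr0n/= !mulr0 !addr0.
rewrite [RHS]exprMn real_normK ?num_real//; congr (_ * _).
by rewrite -[in RHS]powR_mulrn ?powR_ge0// -powRrM divfK.
Qed.

End normalized.

(** * Asymptotics *)

Lemma jpar_cvgy (R : realType) (alpha : R) : 0 <= alpha -> alpha < 1 ->
  jpar alpha n @[n --> \oo] --> +oo.
Proof.
move=> a0 a1; have := bessel_zero_cvgy (order_shift_bounds a0 a1).
move/cvgryPge => jy; apply/cvgryPge => M; near=> n.
have h : 2 * (`|M| + 1) <= j alpha n.
  by rewrite jE; near: n; exact: jy.
have M0 := normr_ge0 M; have Mle := ler_norm M.
have h2 : `|M| + 1 <= j alpha n / 2 by lra.
apply: (@le_trans _ _ ((`|M| + 1) ^+ 2)); first nra.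
by rewrite ler_sqr ?nnegrE; lra.
Unshelve. all: by end_near. Qed.

Lemma Phi_at0_energy (R : realType) (alpha : R) (n : nat) :
  0 <= alpha -> alpha < 1 -> (0 < n)%N ->
  Phi_at0 alpha n
    = Num.sqrt (2 - alpha) * jpar alpha n `^ (order_shift alpha / 2)
      / Num.sqrt (energy (order_shift alpha) 0 (jpar alpha n)).
Proof.
move=> a0 a1 n0; rewrite Phi_at0E// energy_jpar// sqrtr_sqr.
have T0 : 0 < jpar alpha n by rewrite exprn_gt0// divr_gt0// j_gt0.
have p0 := powR_gt0 (order_shift alpha / 2) T0.
have g0 : 0 < `|hyp (order_shift alpha) 0 (jpar alpha n)|.
  by rewrite normr_gt0 hyp_jpar_neq0.
rewrite (ger0_norm (ltW (mulr_gt0 p0 g0))).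
by field; rewrite !gt_eqF.
Qed.

(** The square root of the limit of the energy, along the sequence of zeros. *)
Lemma energy_jpar_cvg (R : realType) (alpha : R) : 0 <= alpha -> alpha < 1 ->
  Num.sqrt (energy (order_shift alpha) 0 (jpar alpha n)) @[n --> \oo]
    --> Gamma (1 - nu alpha) / Num.sqrt pi.
Proof.
move=> a0 a1; have /andP[k0 k1] := order_shift_bounds a0 a1.
have hk : 0 <= order_shift alpha <= 1 / 2 by rewrite k0 ltW.
have -> : 1 - nu alpha = order_shift alpha + 1 / 2.
  by rewrite /order_shift; field.
have c0 : 0 < order_shift alpha + 1 / 2 by lra.
have /cvg_pinftyP/(_ _ (jpar_cvgy a0 a1)) := energy_lim hk.
move=> /(continuous_cvg _ (@sqrt_continuous _ _)).
by rewrite sqrtrM ?sqr_ge0// sqrtr_sqr sqrtrV ?pi_ge0// ger0_norm//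
  ltW// Gamma_gt0.
Qed.

(** All powers of j and of 2 cancel: the ratio is exactly sqrt(L / V(T_n)),
    with V the energy and L its limit. *)
Lemma Phi_at0_ratio (R : realType) (alpha : R) (n : nat) :
  0 <= alpha -> alpha < 1 -> (0 < n)%N ->
  Phi_at0 alpha n
    / (cminus (nu alpha) * Num.sqrt ((2 - alpha) * pi / 2)
       * j alpha n `^ (1 / 2 - nu alpha))
  = Gamma (1 - nu alpha) / Num.sqrt pi
    / Num.sqrt (energy (order_shift alpha) 0 (jpar alpha n)).
Proof.
move=> a0 a1 n0; rewrite Phi_at0_energy//.
have y0 := j_gt0 a0 a1 n0; have y2 : 0 < j alpha n / 2 by rewrite divr_gt0.
have T0 : 0 < jpar alpha n by rewrite exprn_gt0.
have -> : jpar alpha n `^ (order_shift alpha / 2)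
    = (j alpha n / 2) `^ order_shift alpha.
  by rewrite /jpar -powR_mulrn ?(ltW y2)// -powRrM; congr (_ `^ _); field.
have -> : 1 / 2 - nu alpha = order_shift alpha by [].
have -> : j alpha n `^ order_shift alpha
    = 2 `^ order_shift alpha * (j alpha n / 2) `^ order_shift alpha.
  by rewrite -powRM ?(ltW y2)// mulrC divfK.
rewrite /cminus.
have e2 : 2 `^ nu alpha * 2 `^ order_shift alpha = Num.sqrt 2 :> R.
  rewrite -powRD; last by rewrite pnatr_eq0 implybT.
  have -> : nu alpha + order_shift alpha = 2^-1 by rewrite /order_shift; field.
  by rewrite powR12_sqrt.
have s0 : 0 < 2 - alpha by lra.
have -> : Num.sqrt ((2 - alpha) * pi / 2)
    = Num.sqrt (2 - alpha) * Num.sqrt pi / Num.sqrt 2.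
  by rewrite sqrtrM ?mulr_ge0 ?pi_ge0 ?(ltW s0)// sqrtrM ?(ltW s0)// sqrtrV.
have E0 : 0 < Num.sqrt (energy (order_shift alpha) 0 (jpar alpha n)).
  rewrite sqrtr_gt0 energy_jpar// exprn_gt0// mulr_gt0 ?powR_gt0//.
  by rewrite normr_gt0 hyp_jpar_neq0.
have g0 : 0 < Gamma (1 - nu alpha).
  have -> : 1 - nu alpha = order_shift alpha + 1 / 2.
    by rewrite /order_shift; field.
  by rewrite Gamma_gt0// order_shiftE// invr_gt0.
rewrite -e2; have q0 := powR_gt0 (order_shift alpha) y2.
have u0 : 0 < 2 `^ nu alpha :> R by rewrite powR_gt0.
have v0 : 0 < 2 `^ order_shift alpha :> R by rewrite powR_gt0.
have w0 : 0 < Num.sqrt (pi : R) by rewrite sqrtr_gt0 pi_gt0.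
have z0 : 0 < Num.sqrt (2 - alpha) by rewrite sqrtr_gt0.
move: E0 g0 q0 u0 v0 w0 z0; move: (Num.sqrt (energy _ _ _)) (Gamma _)
  (_ `^ order_shift alpha) (2 `^ nu alpha) (2 `^ order_shift alpha)
  (Num.sqrt (pi : R)) (Num.sqrt (2 - alpha)).
move=> E g q u v w z E0 g0 q0 u0 v0 w0 z0.
by field; rewrite !gt_eqF.
Qed.

Theorem lemma5p1 (R : realType) (alpha : R)
    (halpha0 : 0 <= alpha) (halpha1 : alpha < 1) :
  [/\ forall n : nat, (1 <= n)%N ->
        [/\ cvg (Phi alpha n x @[x --> 0^'+]),
            cvg (Phi alpha n x @[x --> 1^'-])
          & `|Phi_at1 alpha n| = Num.sqrt (2 - alpha)],
      Phi_at0 alpha n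
        / (cminus (nu alpha) * Num.sqrt ((2 - alpha) * pi / 2)
           * j alpha n `^ (1 / 2 - nu alpha)) @[n --> \oo] --> (1 : R)
    & [bounded Phi_at0 alpha n | n in [set n : nat | (1 <= n)%N]]
        <-> alpha = 0].
Proof.
have Ec := energy_jpar_cvg halpha0 halpha1.
have L0 : 0 < Gamma (1 - nu alpha) / Num.sqrt pi.
  have -> : 1 - nu alpha = order_shift alpha + 1 / 2.
    by rewrite /order_shift; field.
  rewrite divr_gt0 ?sqrtr_gt0 ?pi_gt0// Gamma_gt0// order_shiftE// invr_gt0.
  lra.
have cV : (Num.sqrt (energy (order_shift alpha) 0 (jpar alpha n)))^-1 @[n --> \oo]
    --> (Gamma (1 - nu alpha) / Num.sqrt pi)^-1.
  by apply: cvgV => //; rewrite gt_eqF.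
split.
- move=> n n0; split; last exact: Phi_at1_norm.
    by apply/cvg_ex; eexists; exact: Phi_cvg0.
  by apply/cvg_ex; eexists; exact: Phi_cvg1.
- have c : Gamma (1 - nu alpha) / Num.sqrt pi
      / Num.sqrt (energy (order_shift alpha) 0 (jpar alpha n)) @[n --> \oo]
      --> Gamma (1 - nu alpha) / Num.sqrt pi
          / (Gamma (1 - nu alpha) / Num.sqrt pi).
    by apply: cvgM => //; exact: cvg_cst.
  rewrite divff ?gt_eqF// in c; apply: cvg_trans c; apply: near_eq_cvg.
  near=> n; rewrite Phi_at0_ratio//.
  by near: n; exact: nbhs_infty_gt.
- split => [bnd|alpha0].
    apply/(order_shift_eq0 halpha1)/eqP; apply: contraT => kn0.
    have /andP[k0 _] := order_shift_bounds halpha0 halpha1.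
    have kp : 0 < order_shift alpha / 2 by rewrite divr_gt0// lt_neqAle
      eq_sym kn0.
    have [M [_ hM]] := bnd.
    have Tc : jpar alpha n `^ (order_shift alpha / 2) @[n --> \oo] --> +oo.
      exact: cvg_comp (jpar_cvgy halpha0 halpha1) (powR_cvgy kp).
    have s0 : 0 < Num.sqrt (2 - alpha) by rewrite sqrtr_gt0; lra.
    pose L := Gamma (1 - nu alpha) / Num.sqrt pi.
    have big : \forall n \near \oo, (L + 1) * (`|M| + 1) / Num.sqrt (2 - alpha)
        < jpar alpha n `^ (order_shift alpha / 2).
      by move/cvgryPgt : Tc; exact.
    have small : \forall n \near \oo,
        Num.sqrt (energy (order_shift alpha) 0 (jpar alpha n)) < L + 1.
      by apply: (cvgr_lt _ Ec); rewrite ltrDl.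
    have pos : \forall n \near \oo,
        0 < Num.sqrt (energy (order_shift alpha) 0 (jpar alpha n)).
      exact: (cvgr_gt _ Ec).
    have [N [[h1 h2] [h3 N0]]] : exists n,
        ((L + 1) * (`|M| + 1) / Num.sqrt (2 - alpha)
          < jpar alpha n `^ (order_shift alpha / 2) /\
        Num.sqrt (energy (order_shift alpha) 0 (jpar alpha n)) < L + 1) /\
        (0 < Num.sqrt (energy (order_shift alpha) 0 (jpar alpha n)) /\
        (0 < n)%N).
      near \oo => n; exists n; split; split.
      - by near: n; exact: big.
      - by near: n; exact: small.
      - by near: n; exact: pos.
      - by near: n; exact: nbhs_infty_gt.
    have M1 : M < `|M| + 1 by have := ler_norm M; lra.
    have /= := hM _ M1 N N0; rewrite Phi_at0_energy//.
    have p0 := powR_ge0 (jpar alpha N) (order_shift alpha / 2).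
    rewrite ger0_norm; last first.
      by apply: divr_ge0; [apply: mulr_ge0; [exact: ltW|] | exact: ltW].
    rewrite ler_pdivrMr// => h4; exfalso; move: h1; rewrite ltr_pdivrMr// ltNge.
    move/negP; apply; rewrite mulrC; apply: (le_trans h4); rewrite mulrC.
    by apply: ler_wpM2r; [have := normr_ge0 M; lra | exact: ltW].
have k0 : order_shift alpha = 0 by apply/order_shift_eq0.
have c : Num.sqrt (2 - alpha)
    / Num.sqrt (energy (order_shift alpha) 0 (jpar alpha n)) @[n --> \oo]
    --> Num.sqrt (2 - alpha) * (Gamma (1 - nu alpha) / Num.sqrt pi)^-1.
  by apply: cvgM => //; exact: cvg_cst.
have /cvg_seq_bounded [M [Mr hM]] :
    cvgn (fun n => Num.sqrt (2 - alpha)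
      / Num.sqrt (energy (order_shift alpha) 0 (jpar alpha n))).
  by apply/cvg_ex; eexists; exact: c.
exists M; split => // x Mx n n0 /=.
rewrite Phi_at0_energy// [X in _ `^ (X / 2)]k0 mul0r powRr0 mulr1.
exact: hM.
Unshelve. all: by end_near. Qed.
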